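(* Let $t_g$ be a gauged stable ribbon tree of arity $n\geqslant 2$ whose gauge intersects exactly $j$ vertices, with underlying stable ribbon tree $t$ and orientation $\omega=e_1\wedge\cdots\wedge e_i$. Consider a (below-break) boundary component of $\overline{\mathcal{CT}}_n(t_g)$ with resulting broken gauged tree $(t_{br})_g$, let $t^1_g,\dots,t^s_g$ be the non-trivial unbroken gauged trees of $(t_{br})_g$ ordered from left to right, and let $e_{j_1},\dots,e_{j_s}$ be the internal edges of $t$ whose breaking produces $t^1_g,\dots,t^s_g$ respectively. Let $\varepsilon(j_1,\dots,j_s;\omega)$ be the parity of the permutation moving $e_{j_k}$ to the $k$-th spot of $\omega$ for $k=1,\dots,s$, i.e. $\omega=(-1)^{\varepsilon(j_1,\dots,j_s;\omega)}e_{j_1}\wedge\cdots\wedge e_{j_s}\wedge\omega_{br}$, where $\omega_{br}$ is the induced ordering of the remaining internal edges. Then the boundary component $\mathcal{CT}_n((t_{br})_g,\omega_{br})$ bears a $(-1)^{\varepsilon(j_1,\dots,j_s;\omega)+1+j}$ sign in the boundary of $\overline{\mathcal{CT}}_n(t_g,\omega)$.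
   Context: A ribbon tree is a planar rooted tree with one outgoing external edge, whose adjacent vertex is the root $r$, and $n$ incoming external edges ordered from left to right; it is stable if all vertices are at least trivalent. $E(t)$ is its set of internal edges, $e(t)=|E(t)|$. An orientation is an ordering of the finite (non-broken) internal edges up to even permutation. A gauged stable ribbon tree $t_g$ is a stable ribbon tree $t$ with a partition of its vertices into vertices below the gauge (between gauge and outgoing edge), on the gauge, and above the gauge, such that the parent (next vertex towards $r$) of any vertex below or on the gauge is below the gauge. The trivial gauged tree is the arity 1 tree consisting of a single edge crossed by a gauge. $\mathcal{CT}_n(t_g)$ is the polyhedral cone of $(\lambda,(l_e)_{e\in E(t)})\in\mathbb R\times\,]0,+\infty[^{e(t)}$ with $-\lambda>d(r,v)$ for $v$ below, $-\lambda=d(r,v)$ for $v$ on, $-\lambda<d(r,v)$ for $v$ above the gauge ($d(r,v)$ = sum of the lengths on the path from $r$ to $v$). The orientation $\omega$ orients it, giving $\mathcal{CT}_n(t_g,\omega)$: if no vertex is on the gauge, as an open subset of $\mathbb R\times\,]0,+\infty[^{e(t)}$ ($\lambda$ first, then the lengths ordered by $\omega$); in general, with $v_1,\dots,v_j$ the vertices on the gauge from left to right and $\nu_k$ outward-pointing for the half-space $-\lambda\geqslant d(r,v_k)$ (e.g. the gradient of $\lambda+d(r,v_k)$), it is cooriented by $(\nu_1,\dots,\nu_j)$ (coorientation followed by orientation is positive). Compactification: let $t_c$ be obtained by colouring the vertices on the gauge and adding a coloured vertex at each intersection of the gauge with the interior of an edge; points of $\mathcal{CT}_n(t_g)$ are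 lengths of the internal edges of $t_c$ such that all paths from coloured vertices to $r$ have equal length; $\overline{\mathcal{CT}}_n(t_g)$ is obtained by letting these lengths go to $0$ (collapse) or $+\infty$ (break) subject to these equalities. (below-break): codimension one boundary component in which edges (internal or incoming) of $t$ located below the gauge or intersecting it break below the gauge, exactly one on each non-self-crossing path from an incoming edge to the root. The result $(t_{br})_g$ consists of an ungauged stable ribbon tree, to each incoming edge of which a gauged tree is grafted through a broken edge: the part of $t_g$ above a breaking internal edge, with the induced gauge (crossing its outgoing edge if the breaking edge intersects the gauge), or the trivial gauged tree for a breaking incoming edge. Its stratum is the set of $(\lambda_1,\dots,\lambda_s,(l_e))\in\mathbb R^s\times\,]0,+\infty[^{e(t)-s}$ ($e$ running over the non-broken internal edges) satisfying for each $i$ the (in)equalities of $t^i_g$ with gauge $\lambda_i$ and root $r_i$. It is oriented by $\omega_{br}$ as an open subset of $\mathbb R^s\times\,]0,+\infty[^{e(t)-s}$ if no vertex lies on a gauge, and in general it is cooriented by the vectors outward-pointing for the half-spaces $-\lambda_i\geqslant d(r_i,v)$, $v$ a vertex of $t^i_g$ on the gauge, ordered by $i=1,\dots,s$ and then from left to right. A codimension one stratum with a given orientation bears the sign $\pm$ in the boundary according to whether the boundary orientation (outward-pointing vector first) agrees with the given one or not. *)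

(* Defs.v *)
From HB Require Import structures.
From mathcomp Require Export all_boot all_order all_algebra all_fingroup.
From mathcomp Require Export all_classical all_reals all_analysis.
Export Order.TTheory GRing.Theory Num.Theory numFieldNormedType.Exports.
Set Implicit Arguments.
Unset Strict Implicit.
Unset Printing Implicit Defensive.

Local Open Scope classical_set_scope.
Local Open Scope ring_scope.

(* A planar rooted tree: [Leaf] is the tree reduced to one edge, [Node ts] is
   a vertex whose incoming edges carry the trees [ts], from left to right. *)
Inductive ribbon_tree := Leaf | Node of seq ribbon_tree.

(* The list of the child indices met when climbing from the root to the top end
   of an edge.  It names that edge and, when the edge does not end in a leaf,
   the vertex at its top as well: an internal edge has the name of its upper
   vertex, and [::] names both the root and the outgoing edge. *)
Definition address := seq nat.

Definition graft (ss : seq (seq address)) : seq address :=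
  flatten [seq [seq i :: a | a <- nth [::] ss i] | i <- iota 0 (size ss)].

(* Both lists are in depth-first order.  On addresses none of which is a prefix
   of another, this is the order from left to right. *)
Fixpoint vertices (t : ribbon_tree) : seq address :=
  if t is Node ts then [::] :: graft (map vertices ts) else [::].

Fixpoint incoming_edges (t : ribbon_tree) : seq address :=
  if t is Node ts then graft (map incoming_edges ts) else [:: [::]].

Definition internal_edges (t : ribbon_tree) : seq address :=
  [seq a <- vertices t | a != [::]].

Definition arity (t : ribbon_tree) : nat := size (incoming_edges t).

Fixpoint stable (t : ribbon_tree) : bool :=
  if t is Node ts then (2 < (size ts).+1)%N && all stable ts else true.

(* The lower end of a (non outgoing) edge, or the next vertex towards the
   root. *)
Definition parent (a : address) : address := take (size a).-1 a.

Variant position := Below | On | Above.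

Definition position_eqb (x y : position) : bool :=
  match x, y with
  | Below, Below | On, On | Above, Above => true
  | _, _ => false
  end.

Lemma position_eqP : Equality.axiom position_eqb.
Proof. by case; case; constructor. Qed.

HB.instance Definition _ := hasDecEq.Build position position_eqP.

(* Only the values of [g] at the vertices of [t] matter. *)
Definition is_gauge (t : ribbon_tree) (g : address -> position) : Prop :=
  {in internal_edges t, forall v, g v != Above -> g (parent v) = Below}.

Definition gauge_vertices (t : ribbon_tree) (g : address -> position) :
  seq address := [seq v <- vertices t | g v == On].

(* The gauge meets the interior of the edge [a] (incoming edges go up to
   infinity, the outgoing one goes down to infinity). *)
Definition crossed (t : ribbon_tree) (g : address -> position) (a : address) :
    bool :=
  ((a \in incoming_edges t) || (a \in vertices t) && (g a == Above)) &&
  ((a == [::]) || (g (parent a) == Below)).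

Definition path_edges (a : address) : seq address :=
  [seq take k.+1 a | k <- iota 0 (size a)].

(* [B] is the set of the breaking edges. *)
Definition below_break (t : ribbon_tree) (g : address -> position)
    (B : pred address) : Prop :=
  (forall b, B b ->
     [/\ b != [::], b \in internal_edges t ++ incoming_edges t &
         (b \in internal_edges t) && (g b != Above) || crossed t g b]) /\
  {in incoming_edges t, forall l, count B (path_edges l) = 1%N}.

(* The breaking edges producing the nontrivial gauged trees t^1, ..., t^s.  As
   an address, the k-th one is also the root r_k of t^k; the vertices of t^k
   are the vertices of [t] having r_k as a prefix. *)
Definition broken_roots (t : ribbon_tree) (B : pred address) : seq address :=
  [seq b <- internal_edges t | B b].

Section Cells.
Context {R : realType}.

Definition coord N (x : 'rV[R]_N) (k : nat) : R :=
  if insub k is Some i then x ord0 i else 0.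

(* In what follows [rs] lists the roots of the unbroken gauged trees and
   [omega] the non-broken internal edges.  A vector x of
   R^(size rs + size omega) consists of one gauge parameter for each element
   of [rs], followed by the lengths of the edges in the order [omega].  The
   unbroken tree [t] itself corresponds to rs = [:: [::]]. *)
Definition gauge_param (rs omega : seq address)
  (x : 'rV[R]_(size rs + size omega)) (b : address) : R := coord x (index b rs).

Definition edge_length (rs omega : seq address)
    (x : 'rV[R]_(size rs + size omega)) (e : address) : R :=
  coord x (size rs + index e omega).

(* The sum of the lengths on the path from [b] up to [v]. *)
Definition dist (l : address -> R) (b v : address) : R :=
  \sum_(size b <= k < size v) l (take k.+1 v).

Definition cell (t : ribbon_tree) (g : address -> position)
    (rs omega : seq address) : set 'rV[R]_(size rs + size omega) :=
  [set x | {in omega, forall e, 0 < edge_length x e} /\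
    {in rs & vertices t, forall b v, prefix b v ->
       match g v return Prop with
       | Below => - gauge_param x b > dist (edge_length x) b v
       | On => - gauge_param x b = dist (edge_length x) b v
       | Above => - gauge_param x b < dist (edge_length x) b v
       end}].

(* The gradient of a linear form. *)
Definition gradient N (f : 'rV[R]_N -> R) : 'rV[R]_N :=
  \row_k f (delta_mx ord0 k).

Definition coorientation (t : ribbon_tree) (g : address -> position)
    (rs omega : seq address) : seq 'rV[R]_(size rs + size omega) :=
  flatten [seq [seq gradient (fun x : 'rV[R]_(size rs + size omega) =>
                        gauge_param x b + dist (edge_length x) b v)
               | v <- gauge_vertices t g & prefix b v] | b <- rs].

End Cells.

(* The edges of t_c: an edge of [t] that the gauge does not cross, or the part
   below, respectively above, the coloured vertex of an edge that it crosses. *)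
Variant tc_part := Whole of address | Lower of address | Upper of address.

Definition is_internal_tc (t : ribbon_tree) (g : address -> position)
    (p : tc_part) : bool :=
  match p with
  | Whole a => (a \in internal_edges t) && ~~ crossed t g a
  | Lower a => (a != [::]) && crossed t g a
  | Upper a => (a \in vertices t) && crossed t g a
  end.

Definition tc_edge (t : ribbon_tree) (g : address -> position) :=
  {p : tc_part | is_internal_tc t g p}.

Section Compactification.
Context {R : realType}.

(* The root of the unbroken gauged tree which contains the vertex [a]. *)
Definition root_of (rs : seq address) (a : address) : address :=
  nth [::] rs (find (fun b => prefix b a) rs).

(* The lengths of the edges of t_c at a point of [cell t g rs omega], where [B]
   is the set of the broken edges.  A broken edge which the gauge crosses breaks
   below its coloured vertex. *)
Definition tc_lengths (t : ribbon_tree) (g : address -> position)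
    (B : pred address) (rs omega : seq address)
    (x : 'rV[R]_(size rs + size omega)) : {ptws tc_edge t g -> \bar R} :=
  fun p => match val p with
  | Whole a => if B a then +oo%E else (edge_length x a)%:E
  | Lower a =>
      if B a then +oo%E else
      let b := root_of rs (parent a) in
      (- gauge_param x b - dist (edge_length x) b (parent a))%:E
  | Upper a =>
      let b := root_of rs a in
      (gauge_param x b + dist (edge_length x) b a)%:E
  end.

End Compactification.

Section BoundarySign.
Context {R : realType}.

Definition frame_det N (vs : seq 'rV[R]_N) : R :=
  \det (\matrix_(i < N) nth 0 vs i).

Definition tangent N (nu : seq 'rV[R]_N) (u : 'rV[R]_N) : Prop :=
  {in nu, forall v : 'rV[R]_N, u *m v^T = 0}.

(* For M a cell of gauged trees and [iM] the lengths of the edges of t_c, this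
   lets these lengths go to 0 or +oo while keeping the equalities they satisfy
   on M. *)
Definition compactification N (X : topologicalType) (M : set 'rV[R]_N)
  (iM : 'rV[R]_N -> X) : set X := closure (iM @` M).

Definition collar_dom N' (S V : set 'rV[R]_N') (delta : R) :
    set (R * 'rV[R]_N') :=
  [set z | 0 <= z.1 < delta /\ (V `&` S) z.2].

Definition collar_map N N' (X : topologicalType) (iM : 'rV[R]_N -> X)
    (iS : 'rV[R]_N' -> X) (c : R * 'rV[R]_N' -> 'rV[R]_N)
    (z : R * 'rV[R]_N') : X :=
  if z.1 == 0 then iS z.2 else iM (c z).

(* A collar, over V `&` S, of the stratum S in the compactification of M: a
   homeomorphism from [0, delta[ x (V `&` S) onto an open subset of the
   compactification, which is [iS] on {0} x (V `&` S) and is given on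
   ]0, delta[ x (V `&` S) by a differentiable map [c] with values in M. *)
Record collar N N' (X : topologicalType)
    (M : set 'rV[R]_N) (iM : 'rV[R]_N -> X)
    (S : set 'rV[R]_N') (iS : 'rV[R]_N' -> X)
    (V : set 'rV[R]_N') (delta : R) (c : R * 'rV[R]_N' -> 'rV[R]_N) : Prop := {
  collar_in : forall z, collar_dom S V delta z -> 0 < z.1 -> M (c z);
  collar_diff :
    forall z, collar_dom S V delta z -> 0 < z.1 -> differentiable c z;
  collar_continuous :
    {within collar_dom S V delta, continuous (collar_map iM iS c)};
  collar_inj : set_inj (collar_dom S V delta) (collar_map iM iS c);
  collar_open : forall W, open W -> exists2 O, open O &
    collar_map iM iS c @` (collar_dom S V delta `&` W) =
    O `&` compactification M iM
}.

(* M and S, which are open in linear subspaces of R^N and R^N', are cooriented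
   by [nuM] and [nuS]: a frame of the tangent space is positive when the
   coorientation followed by the frame has a positive determinant.  S bears the
   sign (-1)^k in the boundary of the compactification of M when, along a collar
   around each of its points, -d/dtau (the outward-pointing vector, tau being the
   collar coordinate) followed by a tangent frame of S is positive in M if and
   only if (-1)^k times the frame is positive in S.  By a degree
   argument, this does not depend on the collar. *)
Definition bears_sign N N' (X : topologicalType)
    (M : set 'rV[R]_N) (nuM : seq 'rV[R]_N) (iM : 'rV[R]_N -> X)
    (S : set 'rV[R]_N') (nuS : seq 'rV[R]_N') (iS : 'rV[R]_N' -> X)
    (k : nat) : Prop :=
  (N + size nuS = (N' + size nuM).+1)%N /\
  forall y0, S y0 -> exists (V : set 'rV[R]_N') (delta : R)
      (c : R * 'rV[R]_N' -> 'rV[R]_N),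
    [/\ open V, V y0, 0 < delta, collar M iM S iS V delta c &
      forall (y : 'rV[R]_N') (tau : R) (us : seq 'rV[R]_N'),
        V y -> S y -> 0 < tau < delta ->
        (size nuS + size us = N')%N -> (forall u, u \in us -> tangent nuS u) ->
        Num.sg (frame_det (nuM ++ 'd c (tau, y) (-1, 0) ::
                                  [seq 'd c (tau, y) (0, u) | u <- us])) =
        (-1) ^+ k * Num.sg (frame_det (nuS ++ us))].

End BoundarySign.

(* Main.v *)
(* A collar of the broken cell is obtained by keeping the lengths of the unbroken
   edges, putting lambda = -1/tau, and giving to each breaking internal edge b the
   length for which lambda + d(r, b) = lambda_b; then every vertex above b lies on
   the same side of the gauge before and after the breaking, whereas the vertices
   below the breaking edges are below the gauge as soon as tau is small.  As
   tau -> 0 the lengths in t_c of the broken edges tend to +oo and those of all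
   other edges do not move.  Conversely (-1/lambda, (lambda + d(r, b))_b, (l_e)_e)
   can be read off continuously from the lengths of the edges of t_c, which makes
   the collar map injective and, by compactness, open onto its image.

   The linear change of coordinates x |-> (lambda, (lambda + d(r, b))_b, (l_e)_e)
   has determinant (-1)^eps.  In these coordinates -d/dtau is a negative multiple
   of the first basis vector, and the gradients cooriented by the vertices on the
   gauge are pulled back from the broken cell, in the same order.  Moving -d/dtau
   in front of these j covectors gives (-1)^j. *)

From HB Require Import structures.
Require Import Defs.
From mathcomp Require Import ring lra zify.
Set Implicit Arguments.
Unset Strict Implicit.
Unset Printing Implicit Defensive.
Local Open Scope classical_set_scope.
Local Open Scope ring_scope.

(** * Signs of frames *)

Lemma row_mul_tr_eq0 (R : realDomainType) n (v : 'rV[R]_n) :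
  (v *m v^T == 0) = (v == 0).
Proof.
apply/eqP/eqP => [|->]; last by rewrite mul0mx.
move/matrixP => /(_ 0 0); rewrite mxE [RHS]mxE.
under eq_bigr do rewrite mxE -expr2.
move/eqP; rewrite psumr_eq0 => [/allP h|i _]; last exact: sqr_ge0.
apply/rowP => i; rewrite [RHS]mxE; apply/eqP.
by have := h i (mem_index_enum _); rewrite sqrf_eq0.
Qed.

(* The characteristic polynomial of [- (M *m M^T)] is monic and has no positive
   root. *)
Lemma det_gram_ge0 (R : rcfType) m n (M : 'M[R]_(m, n)) :
  0 <= \det (M *m M^T).
Proof.
set p := char_poly (- (M *m M^T)).
have p0 : p.[0] = \det (M *m M^T).
  rewrite /p /char_poly -horner_evalE -det_map_mx; congr (\det _).
  apply/matrixP => i k; rewrite !mxE /= horner_evalE hornerD hornerN hornerC opprK.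
  by rewrite hornerMn hornerX mul0rn add0r.
have p_neq0 x : 0 < x -> p.[x] != 0.
  (* A positive root [x] has an eigenvector [v] with [v *m M *m M^T = - x v], so |vM|^2 + x |v|^2 =
     0. *)
  move=> x0; apply/negP; rewrite -/(root p x) -eigenvalue_root_char.
  move=> /eigenvalueP[v]; rewrite mulmxN => vM; apply/negP; rewrite negbK.
  have : (v *m M) *m (v *m M)^T + x *: (v *m v^T) = 0.
    by rewrite trmx_mul mulmxA -(mulmxA v) scalemxAl -vM mulNmx addrN.
  move/matrixP => /(_ 0 0); rewrite [LHS]mxE [RHS]mxE.
  set u := _ 0 0; rewrite mxE => h.
  have u0 : 0 <= u.
    by rewrite /u mxE; apply: sumr_ge0 => i _; rewrite [_^T _ _]mxE -expr2 sqr_ge0.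
  have v0 : 0 <= (v *m v^T) 0 0.
    by rewrite mxE; apply: sumr_ge0 => i _; rewrite [_^T _ _]mxE -expr2 sqr_ge0.
  have : (v *m v^T) 0 0 = 0 by apply/eqP; have := mulr_ge0 (ltW x0) v0; nra.
  move=> vv; rewrite -row_mul_tr_eq0; apply/eqP/matrixP => i k.
  by rewrite !ord1 vv mxE.
(* A negative value at 0 and a positive one beyond the Cauchy bound would give a positive root. *)
rewrite -p0 leNgt; apply/negP => pneg.
have [b hb] := monic_Cauchy_bound (char_poly_monic (- (M *m M^T))).
set c := Num.max b 1; have c0 : 0 < c by rewrite /c lt_max ltr01 orbT.
have pc : 0 < p.[c] by apply: hb; rewrite /c le_max lexx.
have [x /andP[x0 _] rx] : exists2 x, 0 <= x <= c & root p x.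
  apply: poly_ivt; first exact: ltW.
  by rewrite !ltW.
move: x0; rewrite le_eqVlt => /predU1P[x0|/p_neq0]; last by rewrite (eqP rx) eqxx.
by move: pneg; rewrite [X in p.[X]]x0 (eqP rx) ltxx.
Qed.

(* By orthogonality, [(col_mx (A *m Q^T) W *m Q) *m (col_mx A (W *m Q))^T] is
   block triangular, with Gram matrices on the diagonal. *)
Lemma sgr_det_adjoint (R : rcfType) j k (A : 'M[R]_(j, j + k))
    (W : 'M[R]_(k, j + k)) (Q : 'M[R]_(j + k)) :
  Q \in unitmx -> A *m (W *m Q)^T = 0 ->
  Num.sg (\det (col_mx (A *m Q^T) W)) =
  Num.sg (\det Q) * Num.sg (\det (col_mx A (W *m Q))).
Proof.
set C := W *m Q => Qu AC.
set X := col_mx (A *m Q^T) W; set Y := col_mx A C.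
have CA : C *m A^T = 0 by rewrite -[LHS]trmxK trmx_mul trmxK AC trmx0.
have XQ : X *m Q = col_mx (A *m Q^T *m Q) C by rewrite mul_col_mx.
have XY0 : 0 <= \det (X *m Q) * \det Y.
  rewrite -(det_tr Y) -det_mulmx XQ tr_col_mx mul_col_row CA.
  rewrite det_ublock mulr_ge0 ?det_gram_ge0 //.
  have -> : A *m Q^T *m Q *m A^T = (A *m Q^T) *m (A *m Q^T)^T.
    by rewrite trmx_mul trmxK !mulmxA.
  exact: det_gram_ge0.
(* The nonnegative product leaves open that only one determinant vanishes. Equal left kernels
   exclude this: pairing with [a *m A] removes the [C] part and forces [a *m A = 0]. *)
have ker (v : 'rV_(j + k)) : (v *m (X *m Q) == 0) = (v *m Y == 0).
  rewrite -[v]hsubmxK XQ !mul_row_col; set a := lsubmx v; set c := rsubmx v.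
  apply/eqP/eqP => [h|h].
    have aA : a *m A = 0.
      have h0 : a *m A *m Q^T = 0.
        apply/eqP; rewrite -row_mul_tr_eq0; apply/eqP.
        have := congr1 (mulmx^~ (A^T *m a^T)) h.
        rewrite mul0mx mulmxDl -(mulmxA c) (mulmxA C) CA mul0mx mulmx0 addr0.
        by rewrite !trmx_mul trmxK !mulmxA.
      by rewrite -[a *m A](@mulmxK _ _ _ Q^T) ?unitmx_tr // h0 mul0mx.
    by move: h; rewrite !mulmxA aA !mul0mx.
  have aA : a *m A = 0.
    apply/eqP; rewrite -row_mul_tr_eq0; apply/eqP.
    have := congr1 (mulmx^~ (A^T *m a^T)) h.
    rewrite mul0mx mulmxDl -(mulmxA c) (mulmxA C) CA mul0mx mulmx0 addr0.
    by rewrite !trmx_mul.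
  by move: h; rewrite !mulmxA aA !mul0mx.
have Qd : \det Q != 0 by rewrite -unitfE -unitmxE.
have XQY : (\det (X *m Q) == 0) = (\det Y == 0).
  apply/det0P/det0P => -[v v0 /eqP h]; exists v => //; apply/eqP.
    by rewrite -ker.
  by rewrite ker.
have sXQ : Num.sg (\det (X *m Q)) = Num.sg (\det Y).
  have [Y0|Y0] := eqVneq (\det Y) 0.
    by rewrite Y0; move/eqP: Y0; rewrite -XQY => /eqP ->.
  have XQ0 : \det (X *m Q) != 0 by rewrite XQY.
  move: XY0; case: (ltgtP (\det Y) 0) Y0 => // y _;
    case: (ltgtP (\det (X *m Q)) 0) XQ0 => // x _.
  - by rewrite !ltr0_sg.
  - by rewrite nmulr_lge0 // leNgt x.
  - by rewrite pmulr_lge0 // leNgt x.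
  - by rewrite !gtr0_sg.
move: sXQ; rewrite det_mulmx sgrM => <-.
by rewrite mulrCA -sgrM -expr2 [Num.sg (_ ^+ 2)]gtr0_sg ?mulr1 // exprn_even_gt0.
Qed.

(** Expansion along the first column, whose only nonzero entry is [a], in row [size s1]; the sign
    counts the rows above it. *)
Lemma frame_det_insert (R : realType) N (a : R) (s1 s2 : seq 'rV[R]_N) :
  (size s1 + size s2)%N = N ->
  frame_det ([seq row_mx (0 : 'rV_1) v | v <- s1] ++
             row_mx a%:M 0 :: [seq row_mx (0 : 'rV_1) v | v <- s2]) =
  (-1) ^+ size s1 * a * frame_det (s1 ++ s2).
Proof.
move=> sN; rewrite /frame_det; set s := _ ++ _ :: _.
have lt1 : (size s1 < 1 + N)%N by lia.
pose p : 'I_(1 + N) := Ordinal lt1.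
have nth_s (k : 'I_N) :
    nth 0 s (bump (size s1) k) = row_mx 0 (nth 0 (s1 ++ s2) k).
  have kN : (k < size s1 + size s2)%N by case: k => k /=; lia.
  rewrite !nth_cat size_map; case: (leqP (size s1) k) => h.
    have -> : bump (size s1) k = k.+1 by rewrite /bump h.
    by rewrite ltnNge ltnW ?ltnS //= subSn //= (nth_map 0) // ltn_subLR.
  have -> : bump (size s1) k = k by rewrite /bump leqNgt h.
  by rewrite h (nth_map 0).
have l0 : lshift N ord0 = 0 :> 'I_(1 + N) by apply: val_inj.
rewrite (expand_det_col _ 0) (bigD1 p) //= big1 ?addr0 => [|i ip].
  rewrite mxE nth_cat size_map ltnn subnn /= -{1}l0.
  rewrite row_mxEl mxE eqxx mulr1n /cofactor /= addn0 mulrCA mulrA.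
  congr (_ * \det _); apply/matrixP => i k; rewrite !mxE /= nth_s.
  have -> : lift 0 k = rshift 1 k by apply: val_inj.
  by rewrite row_mxEr.
rewrite eq_sym in ip; have [k -> _] := unlift_some ip.
by rewrite mxE /= nth_s -[X in row_mx _ _ _ X]l0 row_mxEl mxE mul0r.
Qed.

(** List form of [sgr_det_adjoint]. Only signs are compared: as [Q] need not be orthogonal, the
    determinants themselves may differ by a positive factor. *)
Lemma sgr_frame_det_adjoint (R : realType) N (Q : 'M[R]_N)
    (vs ws : seq 'rV[R]_N) :
  \det Q != 0 -> (size vs + size ws)%N = N ->
  (forall v w, v \in vs -> w \in ws -> v *m (w *m Q)^T = 0) ->
  Num.sg (frame_det ([seq v *m Q^T | v <- vs] ++ ws)) =
  Num.sg (\det Q) * Num.sg (frame_det (vs ++ [seq w *m Q | w <- ws])).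
Proof.
move=> Q0; move sv : (size vs) => j; move sw : (size ws) => k e.
subst N => orth.
have splitE (s1 s2 : seq 'rV[R]_(j + k)) : size s1 = j ->
    \matrix_(i < j + k) nth 0 (s1 ++ s2) i =
    col_mx (\matrix_(i < j) nth 0 s1 i) (\matrix_(i < k) nth 0 s2 i).
  move=> s1j; apply/row_matrixP => i; rewrite rowK nth_cat s1j.
  case: (split_ordP i) => l ->; first by rewrite rowKu rowK.
  by rewrite /= addKn rowKd rowK.
have mapE l (s : seq 'rV[R]_(j + k)) P : size s = l ->
    \matrix_(i < l) nth 0 [seq v *m P | v <- s] i =
    (\matrix_(i < l) nth 0 s i) *m P.
  move=> sl; apply/row_matrixP => i; rewrite row_mul !rowK (nth_map 0) //.
  by rewrite sl.
rewrite /frame_det !splitE ?size_map // !mapE //.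
apply: sgr_det_adjoint; first by rewrite unitmxE unitfE.
apply/matrixP => i l; rewrite [LHS]mxE [RHS]mxE.
have := orth (nth 0 vs i) (nth 0 ws l).
rewrite !mem_nth ?sv ?sw // => /(_ isT isT) /matrixP /(_ 0 0).
rewrite mxE [X in _ = X -> _]mxE => h; rewrite -[RHS]h.
apply: eq_bigr => c _; rewrite !mxE; congr (_ * _).
by apply: eq_bigr => d _; rewrite !mxE.
Qed.

(* [nuS] consists of covectors, pulled back by [Q], whereas [w] and [us] are
   vectors, pushed forward by [Q]. *)
Lemma sgr_frame_det (R : realType) N N' (e : N = (1 + N')%N)
    (Q : 'M[R]_(N, 1 + N')) (a : R) (w : 'rV[R]_N) (L : 'rV[R]_N' -> 'rV[R]_N)
    (nuS us : seq 'rV[R]_N') :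
  let d := \det (castmx (e, erefl) Q) in
  d != 0 -> a < 0 -> w *m Q = row_mx a%:M 0 ->
  (forall u, L u *m Q = row_mx 0 u) ->
  (size nuS + size us)%N = N' ->
  (forall u, u \in us -> tangent nuS u) ->
  Num.sg (frame_det ([seq row_mx (0 : 'rV_1) v *m Q^T | v <- nuS] ++
                     w :: [seq L u | u <- us])) =
  Num.sg d * ((-1) ^+ (size nuS).+1 * Num.sg (frame_det (nuS ++ us))).
Proof.
subst N; rewrite castmx_id => /= d0 a0 wQ LQ sN tan.
rewrite (map_comp (mulmx^~ Q^T) (row_mx 0)) sgr_frame_det_adjoint //=; first 1 last.
- by rewrite !size_map addnS sN.
- move=> _ z /mapP[v vS ->]; rewrite inE => /predU1P[->|/mapP[u uS ->]].
    by rewrite wQ tr_row_mx mul_row_col trmx0 mulmx0 mul0mx addr0.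
  rewrite LQ tr_row_mx mul_row_col trmx0 mulmx0 add0r.
  by rewrite -[LHS]trmxK trmx_mul trmxK tan // trmx0.
rewrite wQ -map_comp.
have /eq_map -> : (mulmx^~ Q \o L) =1 row_mx (0 : 'rV_1) by [].
rewrite frame_det_insert //.
by rewrite !sgrM (ltr0_sg a0) exprS mulN1r sgrX sgrN sgr1 mulrN1.
Qed.

(** * Planar trees and breaking edges *)

Local Open Scope nat_scope.

Lemma pairwise_flatten_map (I T : eqType) (r : rel T) (F : I -> seq T) (s : seq I) :
  {in s, forall i, pairwise r (F i)} ->
  pairwise (fun i j => allrel r (F i) (F j)) s ->
  pairwise r (flatten [seq F i | i <- s]).
Proof.
elim: s => //= i s IH hF /andP[/allP hi hs]; rewrite pairwise_cat.
rewrite hF ?mem_head //= IH //; last by move=> k ks; apply: hF; rewrite inE ks orbT.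
rewrite andbT; apply/allrelP => x y Fx /flatten_mapP[k ks Fy].
exact: (allrelP (hi _ ks)).
Qed.

Lemma prefixE_take (T : eqType) (a b : seq T) : prefix a b -> a = take (size a) b.
Proof. by rewrite prefixE => /eqP. Qed.

Lemma prefix_le_take (T : eqType) (a b : seq T) k :
  prefix a b -> size a <= k -> prefix a (take k b).
Proof.
by move=> /prefixE_take ab ak; rewrite prefixE take_takel // -ab.
Qed.

Lemma prefix_total (T : eqType) (a b c : seq T) :
  prefix a c -> prefix b c -> size a <= size b -> prefix a b.
Proof. by move=> ac /prefixE_take {2}->; exact: prefix_le_take. Qed.

Lemma prefix_eq_size (T : eqType) (a b : seq T) :
  prefix a b -> size b <= size a -> a = b.
Proof. by move=> /prefixE_take {2}-> ba; rewrite take_oversize. Qed.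

(** Strict lexicographic order with proper prefixes first, that is, the depth-first order of
    [vertices]. It serves to identify lists by sortedness. *)
Fixpoint lexlt (a b : address) : bool :=
  match a, b with
  | _, [::] => false
  | [::], _ :: _ => true
  | i :: a', k :: b' => (i < k) || (i == k) && lexlt a' b'
  end.

Lemma lexlt_irr : irreflexive lexlt.
Proof. by elim=> //= i a ->; rewrite ltnn andbF. Qed.

Lemma lexlt_trans : transitive lexlt.
Proof.
elim=> [|k b IH] [|i a] [|l c] //=.
move=> /orP[ik|/andP[/eqP-> ab]] /orP[kl|/andP[/eqP<- bc]].
- by rewrite (ltn_trans ik).
- by rewrite ik.
- by rewrite kl.
- by rewrite eqxx (IH _ _ ab bc) orbT.
Qed.

(** When [a] is not a prefix of [b], the comparison is decided at a position present in both, so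
    extensions do not affect it. *)
Lemma lexlt_cat (a b u v : address) :
  lexlt a b -> ~~ prefix a b -> lexlt (a ++ u) (b ++ v).
Proof.
elim: a b => [|i a IH] [|k b] //= /orP[-> //|/andP[/eqP-> ab]].
by rewrite eqxx /= => /(IH _ ab) ->; rewrite orbT.
Qed.

(** The hypothesis is needed for every subtree in the list, hence an induction on the list inside
    the fixpoint. *)
Lemma ribbon_tree_nested_ind (P : ribbon_tree -> Prop) :
  P Leaf ->
  (forall ts, (forall i, i < size ts -> P (nth Leaf ts i)) -> P (Node ts)) ->
  forall t, P t.
Proof.
move=> PL PN; fix IH 1 => -[|ts]; first exact: PL.
apply: PN; elim: ts => [|t ts IHts] i.
  by move=> h; exfalso.
by case: i => [_|i]; [exact: IH | exact: IHts].
Qed.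

Lemma mem_graft (ss : seq (seq address)) (a : address) :
  (a \in graft ss) = if a is i :: a' then a' \in nth [::] ss i else false.
Proof.
apply/flattenP/idP => [[s /mapP[i _ ->] /mapP[a' a's ->]] //|].
case: a => // i a a_i; exists [seq i :: a | a <- nth [::] ss i].
  apply/mapP; exists i => //; rewrite mem_iota /=.
  by rewrite ltnNge; apply: contraL a_i => h; rewrite nth_default.
exact: map_f.
Qed.

(** No bound on [i] appears because the default [Leaf] has no vertex; it does have an incoming edge,
    hence the bound in [mem_incoming_cons]. *)
Lemma mem_vertices_cons ts i a :
  (i :: a \in vertices (Node ts)) = (a \in vertices (nth Leaf ts i)).
Proof.
rewrite inE /= mem_graft; have [h|h] := ltnP i (size ts).
  by rewrite (nth_map Leaf).
by rewrite !nth_default ?size_map.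
Qed.

Lemma mem_incoming_cons ts i a :
  (i :: a \in incoming_edges (Node ts)) =
  (i < size ts) && (a \in incoming_edges (nth Leaf ts i)).
Proof.
rewrite /= mem_graft; have [h|h] := ltnP i (size ts).
  by rewrite (nth_map Leaf).
by rewrite !nth_default ?size_map.
Qed.

Lemma vertices_take t a k : a \in vertices t -> take k a \in vertices t.
Proof.
elim: a t k => [|i a IH] [|ts] [|k] //=; rewrite !mem_vertices_cons.
exact: IH.
Qed.

Lemma incoming_take t a k :
  a \in incoming_edges t -> k < size a -> take k a \in vertices t.
Proof.
elim: a t k => [|i a IH] [|ts] [|k] //=.
by rewrite mem_vertices_cons (mem_incoming_cons ts) => /andP[_]; exact: IH.
Qed.

Lemma incoming_notin_vertices t a : a \in incoming_edges t -> a \notin vertices t.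
Proof.
elim: a t => [|i a IH] [|ts] //; first by rewrite /= mem_graft.
by rewrite mem_vertices_cons mem_incoming_cons => /andP[_]; exact: IH.
Qed.

(** Stability excludes vertices without children, so climbing through first children ends in a
    leaf. *)
Lemma incoming_exists t : stable t -> exists l, l \in incoming_edges t.
Proof.
elim/ribbon_tree_nested_ind: t => [_|[|t ts] IH]; first by exists [::].
  by [].
move=> /= /andP[_ /andP[st _]].
have [l hl] := IH 0 isT st; exists (0 :: l).
by rewrite (mem_incoming_cons (t :: ts)).
Qed.

Lemma vertex_incoming t v : stable t -> v \in vertices t ->
  exists l, [/\ l \in incoming_edges t, prefix v l & size v < size l].
Proof.
elim: v t => [|i v IH] [|ts] // st.
  have [[|i l] hl] := incoming_exists st; first by move: hl; rewrite /= mem_graft.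
  by exists (i :: l).
rewrite mem_vertices_cons; case: (ltnP i (size ts)) => h; last first.
  by rewrite nth_default.
move: st => /= /andP[_ /(all_nthP Leaf) /(_ i h) sti] /(IH _ sti)[l [hl vl sl]].
exists (i :: l).
by rewrite (mem_incoming_cons ts) h /= eqxx.
Qed.

Lemma pairwise_graft (ss : seq (seq address)) :
  {in ss, forall s, pairwise lexlt s} -> pairwise lexlt (graft ss).
Proof.
move=> h; apply: pairwise_flatten_map => [i|].
  rewrite mem_iota /= => hi.
  rewrite pairwise_map; apply: sub_pairwise (h _ (mem_nth _ hi)) => a b /= ab.
  by rewrite eqxx ab orbT.
have: pairwise ltn (iota 0 (size ss)).
  by rewrite -sorted_pairwise ?iota_ltn_sorted //; exact: ltn_trans.
apply: sub_pairwise => i k /= ik.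
by apply/allrelP => _ _ /mapP[a _ ->] /mapP[b _ ->] /=; rewrite ik.
Qed.

Lemma pairwise_vertices t : pairwise lexlt (vertices t).
Proof.
elim/ribbon_tree_nested_ind: t => // ts IH /=; apply/andP; split.
  by apply/allP => -[|i a]; rewrite mem_graft.
apply: pairwise_graft => s /(nthP [::])[i]; rewrite size_map => hi <-.
by rewrite (nth_map Leaf) // IH.
Qed.

Lemma uniq_vertices t : uniq (vertices t).
Proof. by apply: pairwise_uniq (pairwise_vertices t); exact: lexlt_irr. Qed.

Lemma mem_internal t a :
  (a \in internal_edges t) = (a != [::]) && (a \in vertices t).
Proof. exact: mem_filter. Qed.

Lemma parent_prefix (a b : address) :
  prefix a b -> a != b -> prefix a (parent b).
Proof.
move=> ab anb; apply: prefix_le_take => //.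
suff : size a < size b by case: (size b).
by rewrite ltnNge; apply: contra anb => h; rewrite (prefix_eq_size ab).
Qed.

Lemma prefix_parent (a : address) : prefix (parent a) a.
Proof. exact: prefix_take. Qed.

Lemma mem_path_edges (a l : address) :
  (a \in path_edges l) = (a != [::]) && prefix a l.
Proof.
apply/mapP/andP => [[k]|[a0 /prefixE_take al]].
  rewrite mem_iota /= add0n => kl ->; rewrite prefix_take.
  by case: l kl.
exists (size a).-1; last by rewrite prednK ?lt0n ?size_eq0.
rewrite mem_iota /= add0n prednK ?lt0n ?size_eq0 //.
by rewrite al size_take_min geq_minr.
Qed.

Local Close Scope nat_scope.

(** * Coordinates on the cells *)

Section Coordinates.
Context {R : realType}.

Lemma continuous_addr (T : topologicalType) (f h : T -> R) :
  continuous f -> continuous h -> continuous (fun x => f x + h x).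
Proof. by move=> cf ch x; exact: continuousD (cf x) (ch x). Qed.

Lemma continuous_subr (T : topologicalType) (f h : T -> R) :
  continuous f -> continuous h -> continuous (fun x => f x - h x).
Proof. by move=> cf ch x; exact: continuousB (cf x) (ch x). Qed.

Lemma continuous_oppr (T : topologicalType) (f : T -> R) :
  continuous f -> continuous (fun x => - f x).
Proof. by move=> cf x; exact: continuousN (cf x). Qed.

Lemma coordE N (x : 'rV[R]_N) (i : 'I_N) : coord x i = x ord0 i.
Proof. by rewrite /coord valK. Qed.

Lemma coordP N (a : R) (x y : 'rV[R]_N) k :
  coord (a *: x + y) k = a * coord x k + coord y k.
Proof. by rewrite /coord; case: insub => [i|]; rewrite ?mxE // mulr0 addr0. Qed.

Lemma coord_continuous_at N k : continuous (fun x : 'rV[R]_N => coord x k).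
Proof.
rewrite /coord; case: insub => [i|]; first exact: coord_continuous.
by move=> x; exact: cst_continuous.
Qed.

Definition mkvec (rs omega : seq address) (lam len : address -> R) :
    'rV[R]_(size rs + size omega) :=
  \row_i (if (i < size rs)%N then lam (nth [::] rs i)
          else len (nth [::] omega (i - size rs))).

Lemma coord_mkvec rs omega lam len k : (k < size rs + size omega)%N ->
  coord (mkvec rs omega lam len) k =
  if (k < size rs)%N then lam (nth [::] rs k)
  else len (nth [::] omega (k - size rs)).
Proof. by move=> hk; rewrite -[k]/(val (Ordinal hk)) coordE mxE. Qed.

Lemma gauge_param_mkvec rs omega lam len b : b \in rs ->
  gauge_param (mkvec rs omega lam len) b = lam b.
Proof.
move=> hb; have h : (index b rs < size rs)%N by rewrite index_mem.
by rewrite /gauge_param coord_mkvec ?h ?nth_index // ltn_addr.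
Qed.

Lemma edge_length_mkvec rs omega lam len e : e \in omega ->
  edge_length (mkvec rs omega lam len) e = len e.
Proof.
move=> he; rewrite /edge_length coord_mkvec ?ltn_add2l ?index_mem //.
by rewrite ltnNge leq_addr /= addKn nth_index.
Qed.

(** Without repetitions in the lists, [index] reaches every position, so gauge parameters and
    lengths exhaust the coordinates. *)
Lemma vec_ext rs omega (x y : 'rV[R]_(size rs + size omega)) :
  uniq rs -> uniq omega ->
  {in rs, gauge_param x =1 gauge_param y} ->
  {in omega, edge_length x =1 edge_length y} -> x = y.
Proof.
move=> urs uom hl he; apply/rowP => i; case: (split_ordP i) => k ->.
  have := hl _ (mem_nth [::] (ltn_ord k)).
  rewrite /gauge_param index_uniq //.
  by rewrite (coordE x (lshift _ k)) (coordE y (lshift _ k)).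
have := he _ (mem_nth [::] (ltn_ord k)).
rewrite /edge_length index_uniq //.
by rewrite (coordE x (rshift _ k)) (coordE y (rshift _ k)).
Qed.

Lemma gauge_paramP rs omega a (x y : 'rV[R]_(size rs + size omega)) b :
  gauge_param (a *: x + y) b = a * gauge_param x b + gauge_param y b.
Proof. exact: coordP. Qed.

Lemma edge_lengthP rs omega a (x y : 'rV[R]_(size rs + size omega)) b :
  edge_length (a *: x + y) b = a * edge_length x b + edge_length y b.
Proof. exact: coordP. Qed.

Lemma eq_dist (l l' : address -> R) b v :
  (forall k, (size b <= k < size v)%N -> l (take k.+1 v) = l' (take k.+1 v)) ->
  dist l b v = dist l' b v.
Proof. by move=> h; apply: eq_big_nat. Qed.

Lemma dist_cat (l : address -> R) a b v : prefix a b -> prefix b v ->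
  dist l a v = dist l a b + dist l b v.
Proof.
move=> ab bv; rewrite /dist (big_cat_nat (n := size b)) ?size_prefix //=.
congr (_ + _); apply: eq_big_nat => k /andP[_ kb].
by rewrite (prefixE_take bv) take_takel.
Qed.

Lemma dist_refl (l : address -> R) b : dist l b b = 0.
Proof. by rewrite /dist big_geq. Qed.

Lemma dist_parent (l : address -> R) b v : v != [::] -> prefix b (parent v) ->
  dist l b v = dist l b (parent v) + l v.
Proof.
move=> v0 bv; rewrite (dist_cat l bv (prefix_parent v)); congr (_ + _).
have sv : (0 < size v)%N by rewrite lt0n size_eq0.
rewrite /dist [size (parent v)]size_takel ?leq_pred // -{2}(prednK sv).
by rewrite big_nat1 prednK // take_size.
Qed.

Lemma distP rs omega a (x y : 'rV[R]_(size rs + size omega)) b v :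
  dist (edge_length (a *: x + y)) b v =
  a * dist (edge_length x) b v + dist (edge_length y) b v.
Proof.
rewrite /dist mulr_sumr -big_split; apply: eq_bigr => k _; exact: edge_lengthP.
Qed.

Lemma gauge_param_continuous rs omega b :
  continuous (fun x : 'rV[R]_(size rs + size omega) => gauge_param x b).
Proof. exact: coord_continuous_at. Qed.

Lemma edge_length_continuous rs omega b :
  continuous (fun x : 'rV[R]_(size rs + size omega) => edge_length x b).
Proof. exact: coord_continuous_at. Qed.

Lemma dist_continuous rs omega b v :
  continuous (fun x : 'rV[R]_(size rs + size omega) => dist (edge_length x) b v).
Proof.
apply: continuous_big => [|k _]; first exact: add_continuous.
exact: edge_length_continuous.
Qed.

Lemma norm_coord_le N (x : 'rV[R]_N) k : `|coord x k| <= `|x|.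
Proof.
rewrite /coord; case: insub => [i|]; last by rewrite normr0.
rewrite [leRHS]/Num.norm /= mx_normrE.
by apply/bigmax_geP; right => /=; exists (ord0, i).
Qed.

Lemma norm_dist_le rs omega (x : 'rV[R]_(size rs + size omega)) b v :
  `|dist (edge_length x) b v| <= (size v)%:R * `|x|.
Proof.
apply: le_trans (ler_norm_sum _ _ _) _.
apply: (@le_trans _ _ (\sum_(size b <= k < size v) `|x|)).
  by apply: ler_sum => k _; exact: norm_coord_le.
rewrite sumr_const_nat -[leLHS]mulr_natl ler_wpM2r // ler_nat leq_subr //.
Qed.

End Coordinates.

(** * Pointwise convergence *)

Section PointwiseTopology.
Variables (I : Type) (K : topologicalType).

Lemma ptws_proj_cvg (q : {ptws I -> K}) (i : I) :
  (fun p : {ptws I -> K} => p i) @ nbhs q --> q i.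
Proof.
have /cvg_sup/(_ i) h : nbhs q --> q by [].
apply: cvg_trans (@initial_continuous _ _ (fun p : {ptws I -> K} => p i) q).
exact: cvg_app h.
Qed.

Lemma ptws_cvg (T : Type) (F : set_system T) (f : T -> {ptws I -> K})
    (q : {ptws I -> K}) : Filter F ->
  (forall i, f x i @[x --> F] --> q i) -> f @ F --> q.
Proof.
move=> FF h; apply/cvg_sup => i.
rewrite cvg_image; last by rewrite eqEsubset; split=> v // _; exists (cst v).
move=> W /= /h hW; exists ((fun p : {ptws I -> K} => p i) @^-1` W) => //.
by rewrite eqEsubset; split => [_ [p Wp <-] //|v Wv]; exists (cst v).
Qed.

Lemma ptws_hausdorff : hausdorff_space K -> hausdorff_space {ptws I -> K}.
Proof.
move=> hK p q pq; apply/funext => i; apply: hK => A1 A2 hA1 hA2.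
have [x [h1 h2]] := pq _ _ (ptws_proj_cvg hA1) (ptws_proj_cvg hA2).
by exists (x i).
Qed.

End PointwiseTopology.

Lemma filter_forall_in (T : Type) (I : eqType) (F : set_system T) (s : seq I)
    (P : I -> set T) : Filter F ->
  {in s, forall i, F (P i)} -> F [set x | {in s, forall i, P i x}].
Proof.
move=> FF; elim: s => [_|i s IH h]; first exact: filterE.
apply: filterS2 (h i (mem_head _ _)) (IH _) => [x Pi Ps k|k ks].
  by rewrite inE => /predU1P[->//|]; exact: Ps.
by apply: h; rewrite inE ks orbT.
Qed.

Lemma cvg_ext (T : Type) (U : topologicalType) (F : set_system T) (f h : T -> U)
    (a b : U) {FF : Filter F} : f @ F --> a -> a = b ->
  (\forall x \near F, f x = h x) -> h @ F --> b.
Proof. by move=> fa <- fh; apply: cvg_trans fa; exact: near_eq_cvg. Qed.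

(** * Limits of lengths and of coordinate vectors *)

Section RealLimits.
Context {R : realType}.

Lemma EFin_cvg (T : Type) (F : set_system T) (f : T -> R) (a : R) :
  Filter F -> (f x)%:E @[x --> F] --> a%:E -> f @ F --> a.
Proof. by move=> FF /fine_cvg. Qed.

Lemma cvg_toEFin (T : Type) (F : set_system T) (f : T -> R) (a : R)
    {FF : Filter F} : f @ F --> a -> (f x)%:E @[x --> F] --> a%:E.
Proof. by move=> fa; apply/fine_cvgP; split; [exact: filterE | exact: fa]. Qed.

Lemma cvg_vec rs omega (G : set_system 'rV[R]_(size rs + size omega)) y0 :
  uniq rs -> uniq omega -> Filter G ->
  {in rs, forall b, gauge_param y b @[y --> G] --> gauge_param y0 b} ->
  {in omega, forall e, edge_length y e @[y --> G] --> edge_length y0 e} ->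
  G --> y0.
Proof.
move=> urs uom FG hl he A [P hP PA]; apply: filterS PA _ => /=.
apply: filter_forall => i; apply: filter_forall => k.
rewrite (ord1 i) in hP *; have := hP ord0 k.
case: (split_ordP k) => l kl; rewrite kl => hPk.
  have := hl _ (mem_nth [::] (ltn_ord l)); rewrite /gauge_param index_uniq //.
  rewrite (coordE y0 (lshift _ l)) => h.
  have {}h : G [set y | P ord0 (lshift _ l) (coord y l)] := h _ hPk.
  apply: filterS h => y /=.
  by rewrite -(coordE y (lshift _ l)).
have := he _ (mem_nth [::] (ltn_ord l)); rewrite /edge_length index_uniq //.
rewrite (coordE y0 (rshift _ l)) => h.
have {}h : G [set y | P ord0 (rshift _ l) (coord y (size rs + l))] := h _ hPk.
apply: filterS h => y /=.
by rewrite -(coordE y (rshift _ l)).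
Qed.

Lemma vec_continuous (T : topologicalType) rs omega
    (f : T -> 'rV[R]_(size rs + size omega)) : uniq rs -> uniq omega ->
  {in rs, forall b, continuous (fun x => gauge_param (f x) b)} ->
  {in omega, forall e, continuous (fun x => edge_length (f x) e)} ->
  continuous f.
Proof.
move=> urs uom hl he x; apply: cvg_vec => // [b hb|e hm].
  exact: (hl b hb x).
exact: (he e hm x).
Qed.

End RealLimits.

(** * Matrices and differentials of linear maps *)

Section LinearMaps.
Context {R : realType}.

Lemma mulmx_delta_rows N N' (f : 'rV[R]_N -> 'rV[R]_N') (x : 'rV[R]_N) :
  linear f -> x *m (\matrix_i f (delta_mx ord0 i)) = f x.
Proof.
move=> flin; pose fM := GRing.isLinear.Build _ _ _ _ _ flin.
pose fL : {linear 'rV[R]_N -> 'rV[R]_N'} := HB.pack f fM.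
rewrite -[RHS]/(fL x) [in RHS](row_sum_delta x) linear_sum mulmx_sum_row.
by apply: eq_bigr => i _; rewrite linearZ rowK.
Qed.

Lemma gradient_mul N (f : 'rV[R]_N -> R) (x : 'rV[R]_N) :
  (forall a x y, f (a *: x + y) = a * f x + f y) ->
  x *m (gradient f)^T = (f x)%:M.
Proof.
move=> fP; pose h y : 'rV[R]_1 := (f y)%:M.
have hlin : linear h by move=> a u v; rewrite /h fP raddfD /= scale_scalar_mx.
rewrite -[RHS]/(h x) -(mulmx_delta_rows x hlin); congr (_ *m _).
by apply/matrixP => i k; rewrite (ord1 k) !mxE eqxx mulr1n.
Qed.

(** The collar map has this form, since [unbreak] is jointly linear and receives 1/tau as its first
    argument. *)
Lemma is_diff_collar (V W : normedModType R) (w : W) (L : V -> W) (z : R * V) :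
  linear L -> continuous L -> z.1 != 0 ->
  is_diff z (fun z => z.1^-1 *: w + L z.2)
            (fun h => (- z.1 ^- 2 * h.1) *: w + L h.2).
Proof.
move=> Llin Lcont z0.
have l1 : linear (fst : R * V -> R) by [].
pose M1 := GRing.isLinear.Build _ _ _ _ _ l1.
pose L1 : {linear (R * V)%type -> R} := HB.pack (fst : R * V -> R) M1.
have c1 : continuous L1 by move=> x; exact: cvg_fst.
have l2 : linear (fun h : R * V => L h.2) by move=> a u v; rewrite /= Llin.
pose M2 := GRing.isLinear.Build _ _ _ _ _ l2.
pose L2 : {linear (R * V)%type -> W} := HB.pack (fun h : R * V => L h.2) M2.
have c2 : continuous L2.
  by move=> x; apply: (cvg_comp snd L _ (Lcont x.2)); exact: cvg_snd.
have d1 : differentiable L1 z by exact: linear_differentiable.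
have dV : differentiable (fun z : R * V => z.1^-1) z by exact: (differentiableV d1).
have dZ := differentiableZl w dV.
have d2 : differentiable L2 z by exact: linear_differentiable.
apply: DiffDef; first exact: (differentiableD dZ d2).
rewrite (diffD dZ d2) diffZl // (diffV d1) // !diff_lin //.
Qed.

Lemma det_castmx N M (e : N = M) (A : 'M[R]_(N, M)) :
  \det (castmx (e, erefl) A) = \det (castmx (erefl, esym e) A).
Proof. by move: A; subst M => A; rewrite !castmx_id. Qed.

Lemma uniq_path_edges b : uniq (path_edges b).
Proof.
rewrite map_inj_in_uniq ?iota_uniq // => i k; rewrite !mem_iota !add0n /=.
move=> ib kb /(congr1 size); rewrite !size_takel //; exact: succn_inj.
Qed.

(** The path to [b] runs at most once through [a]. This computes the entries of the chart matrix. *)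
Lemma dist_indicator a b : a != [::] ->
  dist (fun e => (e == a)%:R : R) [::] b = (prefix a b)%:R.
Proof.
move=> a0.
have -> : dist (fun e => (e == a)%:R : R) [::] b =
    \sum_(e <- path_edges b) (e == a)%:R.
  by rewrite /path_edges big_map /dist /index_iota subn0.
rewrite -natr_sum; congr (_%:R).
have <- : (a \in path_edges b) = prefix a b by rewrite mem_path_edges a0.
rewrite -count_uniq_mem ?uniq_path_edges // -sumn_count.
by rewrite sumnE big_map.
Qed.

End LinearMaps.

(** * A criterion for collars *)

Section CollarCriterion.
Context {R : realType}.
Variables (N N' : nat) (X : topologicalType).
Variables (M : set 'rV[R]_N) (iM : 'rV[R]_N -> X).
Variables (S V : set 'rV[R]_N') (iS : 'rV[R]_N' -> X) (delta : R).
Variables (c : R * 'rV[R]_N' -> 'rV[R]_N) (r : 'rV[R]_N -> R * 'rV[R]_N').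

Let dom := collar_dom S V delta.
Let f := collar_map iM iS c.

Hypotheses (hausX : hausdorff_space X) (delta_gt0 : 0 < delta).
Hypothesis c_in : forall z, dom z -> 0 < z.1 -> M (c z).
Hypothesis f_cont : {within dom, continuous f}.
Hypothesis rK : forall x, M x -> 0 < (r x).1 /\ c (r x) = x.
(** Replaces the continuity of an inverse of [f], although [r] is not defined on the
    compactification: points of [M] with image near [f z] have retraction near [z]. *)
Hypothesis r_cvg : forall z A, dom z -> nbhs z A ->
  exists2 P, nbhs (f z) P & forall x, M x -> P (iM x) -> A (r x).
(** [dom] need not be open in the ambient space, so [K] is only asked to contain the points of [A']
    that are of the form [r x]. *)
Hypothesis loc_compact : forall z A, dom z -> nbhs z A ->
  exists K A', [/\ compact K, K `<=` dom `&` A, nbhs z A' &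
    forall x, M x -> A' (r x) -> K (r x)].

Lemma collar_map_compactification z : dom z -> compactification M iM (f z).
Proof.
move=> hz; have [/andP[z0 zd] zVS] := hz.
move: z0; rewrite le_eqVlt => /predU1P[z0|z0]; last first.
  apply: subset_closure; rewrite /f /collar_map gt_eqF //.
  by exists (c z) => //; exact: c_in.
move=> U fU; have fz := (subspace_continuousP _ _).1 f_cont z hz.
have /nbhs_ballP[e /= e0 he] : within dom (nbhs z) (f @^-1` U) by exact: fz.
pose z' := (Num.min (e / 2) (delta / 2), z.2).
have z'0 : 0 < z'.1 by rewrite /= lt_min !divr_gt0.
have dz' : dom z'.
  split=> //=; rewrite ltW //= gt_min; apply/orP; right; lra.
exists (f z'); split.
  by rewrite /f /collar_map gt_eqF //; exists (c z') => //; exact: c_in.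
apply: he => //; split; last exact: ballxx.
rewrite /ball /= -z0 sub0r normrN gtr0_norm // gt_min; apply/orP; left; lra.
Qed.

(** Points with the same image are approached by the values of [r] at common points [x] of [M], and
    the source is Hausdorff. *)
Lemma collar_map_inj : set_inj dom f.
Proof.
move=> z1 z2; rewrite !inE => hz1 hz2 e.
apply: (@norm_hausdorff R (R * 'rV[R]_N')%type) => A1 A2 hA1 hA2.
have [P1 hO1 h1] := r_cvg hz1 hA1; have [P2 hO2 h2] := r_cvg hz2 hA2.
rewrite -e in hO2.
have := collar_map_compactification hz1 (filterI hO1 hO2).
move=> [_ [[x Mx <-] [Ox1 Ox2]]].
by exists (r x); split; [exact: h1 | exact: h2].
Qed.

Lemma collar_map_open W : open W -> exists2 P, open P &
  f @` (dom `&` W) = P `&` compactification M iM.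
Proof.
move=> oW.
(* The union of all open sets whose trace on the compactification lies in the image; it remains to
   find one around each image point. *)
pose good := [set P : set X | open P /\
  P `&` compactification M iM `<=` f @` (dom `&` W)].
exists (\bigcup_(P in good) P); first by apply: bigcup_open => P [].
apply/seteqP; split=> [_ [z [hz Wz] <-]|p [[P [_ hO] Op] hp]]; last exact: hO.
split; last exact: collar_map_compactification.
have [K [A' [cK KdW hA' hK]]] := loc_compact hz (open_nbhs_nbhs (conj oW Wz)).
have [P hO hOr] := r_cvg hz hA'.
exists (interior P); last exact: hO.
split; first exact: open_interior.
move=> p [Op hp].
(* The compact image is closed in the Hausdorff space [X], so it contains [p] once it meets every
   neighbourhood of [p]. *)
have clK : closed (f @` K).
  apply: compact_closed => //; apply: continuous_compact => //.
  by apply: continuous_subspaceW f_cont => w /KdW[].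
suff [w Kw <-] : (f @` K) p by exists w => //; exact: KdW.
apply: clK => U hU.
have := hp _ (filterI (open_nbhs_nbhs (conj (@open_interior _ P) Op)) hU).
move=> [_ [[x Mx <-] [Ox Ux]]].
exists (iM x); split=> //; exists (r x).
  by apply: hK => //; apply: hOr => //; exact: interior_subset.
have [r0 rx] := rK Mx.
by rewrite /f /collar_map gt_eqF // rx.
Qed.

Lemma collar_of_retraction : (forall z, dom z -> 0 < z.1 -> differentiable c z) ->
  collar M iM S iS V delta c.
Proof.
by move=> cd; split=> //; [exact: collar_map_inj | exact: collar_map_open].
Qed.

End CollarCriterion.

(** * Cells of a breaking *)

Section Break.
Local Open Scope nat_scope.
Variables (t : ribbon_tree) (g : address -> position) (B : pred address).
Hypotheses (st : stable t) (t_root : [::] \in vertices t).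
Hypotheses (gauge_g : is_gauge t g) (brB : below_break t g B).

Let rs := broken_roots t B.

Lemma mem_broken_roots b : (b \in rs) = [&& B b, b != [::] & b \in vertices t].
Proof. by rewrite mem_filter mem_internal. Qed.

Lemma uniq_broken_roots : uniq rs.
Proof. by rewrite filter_uniq ?filter_uniq ?uniq_vertices. Qed.

Lemma parent_vertex a : a \in internal_edges t ++ incoming_edges t ->
  a != [::] -> parent a \in vertices t.
Proof.
rewrite mem_cat mem_internal => /orP[/andP[_ h] _|h a0].
  exact: vertices_take.
by apply: incoming_take h _; rewrite prednK // lt0n size_eq0.
Qed.

(** Iterates the gauge condition down to the root. *)
Lemma below_of_child v k : v \in vertices t -> g v != Above -> k < size v ->
  g (take k v) = Below.
Proof.
elim/last_ind: v => // v i IH; rewrite size_rcons ltnS => hv gv kv.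
have pv : parent (rcons v i) = v.
  by rewrite /parent size_rcons /= -cats1 take_size_cat.
have gpv : g v = Below.
  rewrite -[v]pv gauge_g // mem_internal hv andbT -size_eq0 size_rcons //.
have hv' : v \in vertices t.
  by have := vertices_take (size v) hv; rewrite -cats1 take_size_cat.
move: kv; rewrite leq_eqVlt => /predU1P[->|kv].
  by rewrite -cats1 take_size_cat.
rewrite -cats1 takel_cat ?IH ?gpv //; exact: ltnW.
Qed.

Lemma break_edge b : B b -> b != [::] /\ b \in internal_edges t ++ incoming_edges t.
Proof. by move=> /(brB.1)[]. Qed.

Lemma break_below b k : B b -> k < size b -> g (take k b) = Below.
Proof.
move=> Bb kb; have [b0 hb cb] := brB.1 _ Bb.
have gp : g (parent b) = Below.
  move: cb => /orP[/andP[hb' gb]|]; first exact: gauge_g.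
  by rewrite /crossed (negPf b0) => /andP[_ /eqP].
have [->|kp] := eqVneq k (size b).-1; first by [].
have <- : take k (parent b) = take k b by rewrite /parent take_takel //; lia.
apply: below_of_child; rewrite ?gp //; first exact: parent_vertex.
by rewrite size_takel ?leq_pred //; lia.
Qed.

Lemma break_of_incoming l : l \in incoming_edges t ->
  exists b, [/\ B b, b != [::] & prefix b l].
Proof.
move=> /(brB.2) h; have /hasP[b] : has B (path_edges l) by rewrite has_count h.
by rewrite mem_path_edges => /andP[b0 bl] Bb; exists b.
Qed.

Lemma break_above a : a \in vertices t ++ incoming_edges t ->
  exists l, l \in incoming_edges t /\ prefix a l.
Proof.
rewrite mem_cat => /orP[/(vertex_incoming st)[l [hl al _]]|ha]; first by exists l.
by exists a; rewrite prefix_refl.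
Qed.

(** An incoming edge above [b'] would otherwise have two breaking edges on its path to the root. *)
Lemma break_antichain b b' : B b -> B b' -> prefix b b' -> b = b'.
Proof.
move=> Bb Bb' bb'; have [b0 _] := break_edge Bb; have [b0' hb'] := break_edge Bb'.
have [l [hl b'l]] : exists l, l \in incoming_edges t /\ prefix b' l.
  apply: break_above; move: hb'; rewrite !mem_cat mem_internal.
  by case/orP => [/andP[_ ->]|->]; rewrite ?orbT.
have := brB.2 _ hl; rewrite -size_filter.
have: b \in [seq x <- path_edges l | B x].
  by rewrite mem_filter Bb mem_path_edges b0 (prefix_trans bb').
have: b' \in [seq x <- path_edges l | B x].
  by rewrite mem_filter Bb' mem_path_edges b0' b'l.
by case: [seq x <- _ | B x] => [|x []] //; rewrite !inE => /eqP -> /eqP ->.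
Qed.

(** Compare [v] with the breaking edge on the path of some incoming edge above [v]: [v] lies either
    in the tree cut off there or strictly under the break. *)
Lemma vertex_cases v : v \in vertices t ->
  (exists2 b, b \in rs & prefix b v) \/
  (g v = Below /\ forall b, b != [::] -> prefix b v -> ~~ B b).
Proof.
move=> hv; have [l [hl vl svl]] := vertex_incoming st hv.
have [b [Bb b0 bl]] := break_of_incoming hl.
have [bv|vb] := leqP (size b) (size v).
  have pbv := prefix_total bl vl bv.
  left; exists b => //; rewrite mem_broken_roots Bb b0 /=.
  by rewrite (prefixE_take pbv) vertices_take.
right; have pvb := prefix_total vl bl (ltnW vb); split.
  by rewrite (prefixE_take pvb) break_below.
move=> b' _ b'v; apply/negP => Bb'.
have e := break_antichain Bb' Bb (prefix_trans b'v pvb).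
by have := size_prefix b'v; rewrite e leqNgt vb.
Qed.

Lemma root_below : g [::] = Below.
Proof.
case: (vertex_cases t_root) => [[b]|[] //].
rewrite mem_broken_roots prefixs0 => /and3P[_ b0 _] b_nil; by rewrite b_nil in b0.
Qed.

Lemma crossed_nonroot a : crossed t g a -> a != [::].
Proof.
apply: contraL => /eqP->; rewrite /crossed root_below andbF orbF eqxx andbT.
by apply/negP => /incoming_notin_vertices; rewrite t_root.
Qed.

Lemma crossed_edge a : crossed t g a -> a \in internal_edges t ++ incoming_edges t.
Proof.
move=> ca; have a0 := crossed_nonroot ca; move: ca => /andP[+ _].
by rewrite mem_cat mem_internal a0 => /orP[->|/andP[->]]; rewrite ?orbT.
Qed.

Lemma crossed_above a : crossed t g a -> a \in vertices t -> g a = Above.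
Proof.
move=> /andP[/orP[/incoming_notin_vertices/negPf->//|/andP[_ /eqP->] //]].
Qed.

(** If the breaking edge met above [a] were not below it, the upper end of [a] would be a vertex
    below the gauge, which a crossed edge forbids. *)
Lemma crossed_unbroken a : crossed t g a -> ~~ B a ->
  exists2 b, b \in rs & prefix b (parent a).
Proof.
move=> ca nBa; have a0 := crossed_nonroot ca; have ha := crossed_edge ca.
have [//|[_ nB]] := vertex_cases (parent_vertex ha a0).
have [l [hl al]] : exists l, l \in incoming_edges t /\ prefix a l.
  apply: break_above; move: ha; rewrite !mem_cat mem_internal.
  by case/orP => [/andP[_ ->]|->]; rewrite ?orbT.
have [b [Bb b0 bl]] := break_of_incoming hl.
have ba : b != a by apply: contraNneq nBa => <-.
have [sba|sab] := leqP (size b) (size a).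
  have := nB b b0 (parent_prefix (prefix_total bl al sba) ba).
  by rewrite Bb.
have pab := prefix_total al bl (ltnW sab).
have ga : g a = Below by rewrite (prefixE_take pab) break_below.
have va : a \in vertices t.
  rewrite (prefixE_take al) incoming_take //.
  by rewrite (leq_trans sab) // size_prefix.
by have := crossed_above ca va; rewrite ga.
Qed.

Lemma crossed_vertex a : crossed t g a -> a \in vertices t ->
  exists2 b, b \in rs & prefix b a.
Proof.
move=> ca va; have [//|[]] := vertex_cases va.
by rewrite (crossed_above ca va).
Qed.

Lemma below_edge_unbroken b k : b \in rs -> k.+1 < size b ->
  (take k.+1 b \in internal_edges t) && ~~ B (take k.+1 b).
Proof.
rewrite mem_broken_roots => /and3P[Bb b0 vb] kb.
rewrite mem_internal vertices_take // -size_eq0 size_takel ?(ltnW kb) //=.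
apply/negP => Bk; have := break_antichain Bk Bb (prefix_take _ _).
move/(congr1 size); rewrite size_takel ?(ltnW kb) // => kb'.
by rewrite kb' ltnn in kb.
Qed.

Lemma above_edge_unbroken b v k : b \in rs -> v \in vertices t ->
  prefix b v -> size b <= k < size v ->
  (take k.+1 v \in internal_edges t) && ~~ B (take k.+1 v).
Proof.
rewrite mem_broken_roots => /and3P[Bb b0 vb] vv bv /andP[bk kv].
rewrite mem_internal vertices_take // -size_eq0 size_takel //=.
apply/negP => Bk; have bkv : prefix b (take k.+1 v).
  by apply: prefix_le_take => //; exact: leqW.
have := break_antichain Bb Bk bkv.
by move/(congr1 size); rewrite size_takel // => bk'; rewrite bk' ltnn in bk.
Qed.

Lemma broken_root_uniq b b' v :
  b \in rs -> b' \in rs -> prefix b v -> prefix b' v -> b = b'.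
Proof.
rewrite !mem_broken_roots => /and3P[Bb _ _] /and3P[Bb' _ _] bv b'v.
have [h|h] := leqP (size b) (size b').
  exact/break_antichain/(prefix_total bv).
by apply/esym/break_antichain => //; apply: (prefix_total b'v) => //; exact: ltnW.
Qed.

Lemma root_ofE b v : b \in rs -> prefix b v -> root_of rs v = b.
Proof.
move=> hb bv; have hs : has (fun b => prefix b v) rs by apply/hasP; exists b.
apply: (broken_root_uniq (v := v)) => //; last exact: (nth_find [::] hs).
by rewrite mem_nth // -has_find.
Qed.

(** Serves to read the gauge parameter of the tree at [b] when the gauge does not cross [b]. Climb
    from [b] along a path to a leaf and stop at the first vertex not below the gauge, or at the
    leaf. *)
Lemma gauge_above_root b : b \in rs -> g b != Above ->
  (exists v, [/\ v \in vertices t, prefix b v & g v = On]) \/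
  (exists a, [/\ crossed t g a, prefix b (parent a) & ~~ B a]).
Proof.
move=> hb gb; have := hb; rewrite mem_broken_roots => /and3P[Bb b0 vb].
have [l [hl bl sbl]] := vertex_incoming st vb.
have gb' : (b \in incoming_edges t) || (g b != Below) ->  g b = On.
  case/orP => [/incoming_notin_vertices|]; first by rewrite vb.
  by case: (g b) gb.
have ex : exists k, (size b <= k) && ((size l <= k) || (g (take k l) != Below)).
  by exists (size l); rewrite leqnn (ltnW sbl).
have [k /andP[bk hk] kmin] := ex_minnP ex.
have kl : k <= size l by apply: kmin; rewrite leqnn (ltnW sbl).
have bkl : prefix b (take k l) by apply: prefix_le_take.
have [kb|kb] := eqVneq k (size b).
  left; exists b; split; rewrite ?prefix_refl // gb' //.
  move: hk; rewrite kb -(prefixE_take bl) => /orP[|->]; rewrite ?orbT //.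
  by rewrite leqNgt sbl.
have bk' : size b < k by rewrite ltn_neqAle eq_sym kb.
have ek : k.-1.+1 = k by rewrite (ltn_predK bk').
have bk1 : size b <= k.-1 by rewrite -ltnS ek.
have pk : parent (take k l) = take k.-1 l.
  by rewrite /parent size_takel // take_takel // leq_pred.
have gp : g (take k.-1 l) = Below.
  apply/eqP; rewrite -[_ == _]negbK; apply/negP => h.
  have /kmin : (size b <= k.-1) && ((size l <= k.-1) || (g (take k.-1 l) != Below)).
    by rewrite bk1 h orbT.
  by rewrite -ltnS ek ltnn.
have bp : prefix b (take k.-1 l) by apply: prefix_le_take.
have nB : ~~ B (take k l).
  apply/negP => Bk; have /(congr1 size) := break_antichain Bb Bk bkl.
  by rewrite size_takel // => kb'; rewrite kb' eqxx in kb.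
have [kl'|kl'] := eqVneq k (size l).
  right; exists (take k l); rewrite pk; split => //.
  by rewrite /crossed pk gp eqxx orbT kl' take_size hl.
have kl2 : k < size l by rewrite ltn_neqAle kl'.
have vk : take k l \in vertices t by rewrite incoming_take.
move: hk; rewrite leqNgt kl2 /=; case gk: (g (take k l)) => //= _.
  by left; exists (take k l).
right; exists (take k l); rewrite pk; split => //.
by rewrite /crossed pk gp vk gk eqxx !orbT.
Qed.

Lemma On_broken_root v : v \in vertices t -> g v = On ->
  exists2 b, b \in rs & prefix b v.
Proof. by move=> hv gv; have [//|[]] := vertex_cases hv; rewrite gv. Qed.

(** Both lists are sorted for [lexlt] and have the same elements; vertices over distinct broken
    roots compare like these roots. Hence the two coorientations list the vertices in the same
    order. *)
Lemma gauge_vertices_broken :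
  flatten [seq [seq v <- gauge_vertices t g | prefix b v] | b <- rs] =
  gauge_vertices t g.
Proof.
have pg : pairwise lexlt (gauge_vertices t g).
  exact/pairwise_filter/pairwise_vertices.
have prs : pairwise lexlt rs.
  exact/pairwise_filter/pairwise_filter/pairwise_vertices.
apply: (irr_sorted_eq lexlt_trans lexlt_irr);
  rewrite ?(sorted_pairwise lexlt_trans) //.
  apply: pairwise_flatten_map => [b _|]; first exact: pairwise_filter.
  have : pairwise (fun b b' => lexlt b b' && ~~ prefix b b') rs.
    apply: (sub_in_pairwise (P := mem rs)) prs; last exact/allP.
    move=> b b' hb hb' bb'; rewrite bb'; apply/negP => pbb'.
    have e := broken_root_uniq hb hb' pbb' (prefix_refl _).
    by rewrite e lexlt_irr in bb'.
  apply: sub_pairwise => b b' /andP[bb' nbb']; apply/allrelP => v v'.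
  rewrite !mem_filter => /andP[/prefixP[u ->] _] /andP[/prefixP[u' ->] _].
  exact: lexlt_cat.
move=> v; apply/flatten_mapP/idP => [[b _]|hv].
  by rewrite mem_filter => /andP[].
have := hv; rewrite mem_filter => /andP[/eqP gv vv].
by have [b hb bv] := On_broken_root vv gv; exists b; rewrite // mem_filter bv.
Qed.

Lemma exists_break : exists b, B b.
Proof.
have [l hl] := incoming_exists st.
by have [b [Bb _ _]] := break_of_incoming hl; exists b.
Qed.

Local Close Scope nat_scope.

(** * Change of coordinates between the unbroken and the broken cells *)

Context {R : realType}.
Variable omega : seq address.
Hypothesis om_t : perm_eq omega (internal_edges t).

Let obr := [seq e <- omega | ~~ B e].

Local Notation gaugedT := 'rV[R]_(size [:: [::] : address] + size omega).
Local Notation brokenT := 'rV[R]_(size rs + size obr).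

Lemma mem_omega e : (e \in omega) = (e != [::]) && (e \in vertices t).
Proof. by rewrite (perm_mem om_t) mem_internal. Qed.

Lemma mem_obr e : (e \in obr) = (e \in internal_edges t) && ~~ B e.
Proof. by rewrite mem_filter (perm_mem om_t) andbC. Qed.

Lemma uniq_omega : uniq omega.
Proof. by rewrite (perm_uniq om_t) filter_uniq ?uniq_vertices. Qed.

Lemma size_broken : (size rs + size obr = size omega)%N.
Proof.
rewrite !size_filter -(seq.permP om_t B) -(count_predC B omega).
by congr (_ + _)%N; apply: eq_count.
Qed.

(* The point of the collar above [y] with [lambda = - s].  Writing
   [s = 1 / tau], the edges [b] that break get the length for which
   [lambda + d(r, b)] is the gauge parameter of the tree cut off at [b]. *)
Definition unbreak (s : R) (y : brokenT) : gaugedT :=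
  mkvec [:: [::]] omega (fun _ => - s) (fun e =>
    if B e then gauge_param y e + s - dist (edge_length y) [::] (parent e)
    else edge_length y e).

Definition to_broken (x : gaugedT) : brokenT :=
  mkvec rs obr (fun b => gauge_param x [::] + dist (edge_length x) [::] b)
    (edge_length x).

Lemma gauge_param_unbreak s y : gauge_param (unbreak s y) [::] = - s.
Proof. by rewrite gauge_param_mkvec ?mem_seq1. Qed.

Lemma edge_length_unbreak s y e : e \in obr ->
  edge_length (unbreak s y) e = edge_length y e.
Proof.
by rewrite mem_filter => /andP[/negPf Be h]; rewrite edge_length_mkvec // Be.
Qed.

Lemma rs_omega b : b \in rs -> b \in omega.
Proof. by rewrite mem_broken_roots mem_omega => /and3P[_ -> ->]. Qed.

Lemma edge_length_unbreak_broken s y e : e \in rs ->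
  edge_length (unbreak s y) e =
  gauge_param y e + s - dist (edge_length y) [::] (parent e).
Proof.
move=> h; rewrite edge_length_mkvec ?rs_omega //.
by move: h; rewrite mem_broken_roots => /and3P[-> _ _].
Qed.

Lemma dist_unbreak_below s y v : v \in vertices t ->
  (forall b, b != [::] -> prefix b v -> ~~ B b) ->
  dist (edge_length (unbreak s y)) [::] v = dist (edge_length y) [::] v.
Proof.
move=> hv nB; apply: eq_dist => k /andP[_ kv]; rewrite edge_length_unbreak //.
have k0 : take k.+1 v != [::] by case: (v) kv.
by rewrite mem_filter nB ?prefix_take // mem_omega vertices_take // k0.
Qed.

Lemma dist_unbreak_parent s y b : B b ->
  dist (edge_length (unbreak s y)) [::] (parent b) =
  dist (edge_length y) [::] (parent b).
Proof.
move=> Bb; have [b0 hb] := break_edge Bb.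
apply: dist_unbreak_below; first exact: parent_vertex.
move=> b' _ bb'; apply/negP => Bb'.
have e := break_antichain Bb' Bb (prefix_trans bb' (prefix_parent b)).
move: bb'; rewrite e => /size_prefix; rewrite size_takel ?leq_pred //.
by rewrite leqNgt ltn_predL lt0n size_eq0 b0.
Qed.

Lemma dist_unbreak_above s y b v : b \in rs -> v \in vertices t -> prefix b v ->
  dist (edge_length (unbreak s y)) b v = dist (edge_length y) b v.
Proof.
move=> hb hv bv; apply: eq_dist => k kv; rewrite edge_length_unbreak // mem_obr.
exact: above_edge_unbroken kv.
Qed.

Lemma height_unbreak_root s y b : b \in rs ->
  gauge_param (unbreak s y) [::] + dist (edge_length (unbreak s y)) [::] b =
  gauge_param y b.
Proof.
move=> hb; have := hb; rewrite mem_broken_roots => /and3P[Bb b0 _].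
rewrite dist_parent // ?prefix0s // dist_unbreak_parent //.
by rewrite gauge_param_unbreak edge_length_unbreak_broken //; ring.
Qed.

(** The sign of the height lambda + d(r, v) decides the side of the gauge, so this equality
    transports the conditions on [v] between the two cells. *)
Lemma height_unbreak s y b v : b \in rs -> v \in vertices t -> prefix b v ->
  gauge_param (unbreak s y) [::] + dist (edge_length (unbreak s y)) [::] v =
  gauge_param y b + dist (edge_length y) b v.
Proof.
move=> hb hv bv; rewrite (dist_cat _ (prefix0s b) bv) addrA.
by rewrite height_unbreak_root // dist_unbreak_above.
Qed.

Lemma unbreak_to_brokenK x : unbreak (- gauge_param x [::]) (to_broken x) = x.
Proof.
apply: vec_ext => //; first exact: uniq_omega.
  by move=> b; rewrite inE => /eqP->; rewrite gauge_param_unbreak opprK.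
have obrE e : e \in obr -> edge_length (to_broken x) e = edge_length x e.
  by move=> he; rewrite edge_length_mkvec.
move=> e he; have [Be|nBe] := boolP (B e); last first.
  have eo : e \in obr by rewrite mem_filter nBe.
  by rewrite edge_length_unbreak // obrE.
have er : e \in rs.
  by move: he; rewrite mem_omega mem_broken_roots Be.
have e0 : e != [::] by move: he; rewrite mem_omega => /andP[].
rewrite edge_length_unbreak_broken // gauge_param_mkvec //.
rewrite dist_parent //; last exact: prefix0s.
suff -> : dist (edge_length (to_broken x)) [::] (parent e) =
          dist (edge_length x) [::] (parent e) by ring.
(* Edges strictly under a breaking edge do not break, so [to_broken x] keeps their lengths. *)
apply: eq_dist => k /andP[_ kp]; apply: obrE; rewrite mem_obr.
have ke : (k.+1 < size e)%N.
  by move: kp; rewrite size_takel ?leq_pred // -ltnS prednK // lt0n size_eq0.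
rewrite /parent take_takel ?below_edge_unbroken //.
by rewrite -ltnS prednK // lt0n size_eq0.
Qed.

Lemma to_broken_unbreakK s y : to_broken (unbreak s y) = y.
Proof.
apply: vec_ext => [||b hb|e he].
- exact: uniq_broken_roots.
- by rewrite filter_uniq // uniq_omega.
- by rewrite gauge_param_mkvec // height_unbreak_root.
- by rewrite edge_length_mkvec // edge_length_unbreak.
Qed.

Lemma unbreakP a s s' y y' :
  unbreak (a * s + s') (a *: y + y') = a *: unbreak s y + unbreak s' y'.
Proof.
apply: vec_ext => // [|b|e he]; first exact: uniq_omega.
  by rewrite inE => /eqP->; rewrite gauge_paramP !gauge_param_unbreak; ring.
rewrite edge_lengthP !edge_length_mkvec // gauge_paramP distP edge_lengthP.
by case: ifP => _; ring.
Qed.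

Lemma to_brokenP a x x' : to_broken (a *: x + x') = a *: to_broken x + to_broken x'.
Proof.
apply: vec_ext => [||b hb|e he].
- exact: uniq_broken_roots.
- by rewrite filter_uniq // uniq_omega.
- by rewrite gauge_paramP !gauge_param_mkvec // gauge_paramP distP; ring.
- by rewrite edge_lengthP !edge_length_mkvec // edge_lengthP.
Qed.

Lemma height_to_broken x b v : b \in rs -> v \in vertices t -> prefix b v ->
  gauge_param (to_broken x) b + dist (edge_length (to_broken x)) b v =
  gauge_param x [::] + dist (edge_length x) [::] v.
Proof.
move=> hb hv bv.
by rewrite -[in RHS](unbreak_to_brokenK x) (height_unbreak _ _ hb hv bv).
Qed.

(** The trichotomy of [cell], isolated because it depends only on [a - d]. *)
Definition position_ok (p : position) (a d : R) : Prop :=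
  match p with Below => a > d | On => a = d | Above => a < d end.

Lemma position_ok_add p (a d a' d' : R) : a + d = a' + d' ->
  position_ok p (- a) d -> position_ok p (- a') d'.
Proof. by case: p => /= h h'; lra. Qed.

Lemma to_broken_cell (x : gaugedT) : cell t g x -> cell t g (to_broken x).
Proof.
move=> [hl hv]; split=> [e|b v hb v_t bv].
  rewrite mem_obr => /andP[e_t nBe]; rewrite edge_length_mkvec ?mem_obr ?e_t //.
  by apply: hl; rewrite mem_omega -mem_internal.
have := hv [::] v (mem_head _ _) v_t (prefix0s v).
by apply: position_ok_add; rewrite height_to_broken.
Qed.

Definition depth := (\max_(v <- vertices t) size v)%N.

Lemma dist_depth_le (y : brokenT) v : v \in vertices t ->
  `|dist (edge_length y) [::] v| <= depth%:R * `|y|.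
Proof.
move=> hv; apply: le_trans (norm_dist_le _ _ _) _.
by rewrite ler_wpM2r // ler_nat; exact: leq_bigmax_seq.
Qed.

(** Distances from the root are at most [depth] times the norm, and one more norm bounds the gauge
    parameters. So the breaking lengths are positive and the vertices under the break are below the
    gauge. *)
Lemma unbreak_cell s (y : brokenT) : cell t g y -> depth.+1%:R * `|y| < s ->
  cell t g (unbreak s y).
Proof.
move=> [hl hv] hs; have y0 : 0 <= `|y| by [].
rewrite mulrSr mulrDl mul1r in hs.
split=> [e he|b v].
  have [Be|nBe] := boolP (B e); last first.
    have eo : e \in obr by rewrite mem_filter nBe.
    by rewrite edge_length_unbreak // hl.
  have er : e \in rs by move: he; rewrite mem_omega mem_broken_roots Be.
  rewrite edge_length_unbreak_broken //.
  have e0 : e != [::] by move: he; rewrite mem_omega => /andP[].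
  have [_ /parent_vertex/(_ e0)/(dist_depth_le y)] := break_edge Be.
  have := norm_coord_le y (index e rs); rewrite -/(gauge_param y e).
  rewrite !ler_norml => /andP[h1 _] /andP[_ h2]; lra.
rewrite inE => /eqP-> v_t _.
have [[b' hb' b'v]|[gv nB]] := vertex_cases v_t.
  have := hv b' v hb' v_t b'v; apply: position_ok_add.
  by rewrite (height_unbreak _ _ hb' v_t b'v).
rewrite gv gauge_param_unbreak opprK dist_unbreak_below //.
by have := dist_depth_le y v_t; rewrite ler_norml => /andP[_ h]; lra.
Qed.

Lemma cell_gauge_param_lt0 (x : gaugedT) : cell t g x -> gauge_param x [::] < 0.
Proof.
move=> [_ /(_ [::] [::] (mem_head _ _) t_root (prefix0s _))].
by rewrite root_below dist_refl => h; lra.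
Qed.

Lemma root_of_root a : root_of [:: [::]] a = [::].
Proof. by rewrite /root_of /= prefix0s. Qed.

(* The lengths of the unbroken edges of t_c do not depend on the collar
   parameter. *)
Lemma tc_lengths_cases (p : tc_edge t g) :
  (exists2 f : brokenT -> R, continuous f &
     forall y, tc_lengths B y p = (f y)%:E /\
       forall s, tc_lengths pred0 (unbreak s y) p = (f y)%:E) \/
  (exists2 f : brokenT -> R, continuous f &
     forall y, tc_lengths B y p = +oo%E /\
       forall s, tc_lengths pred0 (unbreak s y) p = (s + f y)%:E).
Proof.
case: p => -[] a pa; rewrite /tc_lengths /=.
- move: (pa) => /= /andP[]; rewrite mem_internal => /andP[a0 va] _.
  have [Ba|nBa] := boolP (B a); [right|left].
    have ar : a \in rs by rewrite mem_broken_roots Ba a0.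
    exists (fun y => gauge_param y a - dist (edge_length y) [::] (parent a)).
      by apply: continuous_subr;
        [exact: gauge_param_continuous | exact: dist_continuous].
    move=> y; split=> // s; rewrite edge_length_unbreak_broken //.
    by congr EFin; ring.
  exists (fun y => edge_length y a); first exact: edge_length_continuous.
  move=> y; split=> // s.
  by rewrite edge_length_unbreak // mem_obr mem_internal a0 va nBa.
- move: (pa) => /= /andP[a0 ca].
  have [Ba|nBa] := boolP (B a); [right|left].
    exists (fun y => - dist (edge_length y) [::] (parent a)).
      by apply: continuous_oppr; exact: dist_continuous.
    move=> y; split=> // s.
    by rewrite root_of_root gauge_param_unbreak opprK dist_unbreak_parent.
  have [b hb bp] := crossed_unbroken ca nBa.
  exists (fun y => - gauge_param y b - dist (edge_length y) b (parent a)).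
    apply: continuous_subr; last exact: dist_continuous.
    by apply: continuous_oppr; exact: gauge_param_continuous.
  move=> y; split=> [|s]; first by rewrite (root_ofE hb bp).
  have va := parent_vertex (crossed_edge ca) a0.
  by rewrite root_of_root -!opprD (height_unbreak _ _ hb va bp).
- move: (pa) => /= /andP[va ca]; left.
  have [b hb ba] := crossed_vertex ca va.
  exists (fun y => gauge_param y b + dist (edge_length y) b a).
    by apply: continuous_addr;
      [exact: gauge_param_continuous | exact: dist_continuous].
  move=> y; split=> [|s]; first by rewrite (root_ofE hb ba).
  by rewrite root_of_root (height_unbreak _ _ hb va ba).
Qed.

(** Any breaking edge provides one, whole or by its lower part. Its length determines [s], hence the
    collar parameter. *)
Lemma broken_tc_edge : exists p : tc_edge t g, exists2 f : brokenT -> R,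
  continuous f & forall y, tc_lengths B y p = +oo%E /\
    forall s, tc_lengths pred0 (unbreak s y) p = (s + f y)%:E.
Proof.
have [b Bb] := exists_break; have [b0 hb cb] := brB.1 _ Bb.
have [p hp] : exists p : tc_edge t g, forall y : brokenT, tc_lengths B y p = +oo%E.
  have [cb'|ncb] := boolP (crossed t g b).
    have pb : is_internal_tc t g (Lower b) by rewrite /= b0.
    by exists (exist (is_internal_tc t g) _ pb) => y; rewrite /tc_lengths /= Bb.
  have pb : is_internal_tc t g (Whole b).
    by move: cb; rewrite /= (negPf ncb) orbF andbT => /andP[].
  by exists (exist (is_internal_tc t g) _ pb) => y; rewrite /tc_lengths /= Bb.
exists p; case: (tc_lengths_cases p) => [[f _ h]|[f cf h]]; last by exists f.
by have [] := h 0; rewrite hp.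
Qed.

(** * The collar and its retraction *)

Definition collar_pt (z : R * brokenT) : gaugedT := unbreak z.1^-1 z.2.

Definition retract (x : gaugedT) : R * brokenT :=
  ((- gauge_param x [::])^-1, to_broken x).

Let cellM : set gaugedT := @cell R t g [:: [::]] omega.
Let cellS : set brokenT := @cell R t g rs obr.
Let iM : gaugedT -> {ptws tc_edge t g -> \bar R} :=
  @tc_lengths R t g pred0 [:: [::]] omega.
Let iS : brokenT -> {ptws tc_edge t g -> \bar R} := @tc_lengths R t g B rs obr.

Lemma retractK x : cellM x -> 0 < (retract x).1 /\ collar_pt (retract x) = x.
Proof.
move=> /cell_gauge_param_lt0 x0; rewrite /collar_pt /= invrK unbreak_to_brokenK.
by rewrite invr_gt0 oppr_gt0.
Qed.

(** A crossed unbroken edge is the sum of its two parts. The gauge parameter at [b] is read on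
    [Upper b] if [b] is crossed, and otherwise through the vertex or crossed edge given by
    [gauge_above_root]. *)
Lemma broken_tc_lengths_embedding (G : set_system brokenT) y0 : Filter G ->
  G cellS -> cellS y0 -> (forall p, iS y p @[y --> G] --> iS y0 p) ->
  G --> y0.
Proof.
move=> FG GS Sy0 hG.
have hE (f : brokenT -> R) p : iS y0 p = (f y0)%:E ->
    (forall y, cellS y -> iS y p = (f y)%:E) -> f @ G --> f y0.
  move=> p0 pf; apply: EFin_cvg; rewrite -p0; apply: cvg_trans (hG p).
  by apply: near_eq_cvg; apply: filterS GS => y /pf.
have hl e : e \in obr -> edge_length y e @[y --> G] --> edge_length y0 e.
  move=> he; have := he; rewrite mem_obr mem_internal => /andP[/andP[e0 ve] nBe].
  have [ce|nce] := boolP (crossed t g e); last first.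
    have pe : is_internal_tc t g (Whole e) by rewrite /= mem_internal e0 ve nce.
    apply: (hE (fun y => edge_length y e)
      (exist (is_internal_tc t g) _ pe)) => [|y _].
      by rewrite /iS /tc_lengths /= (negPf nBe).
    by rewrite /iS /tc_lengths /= (negPf nBe).
  have [b hb bp] := crossed_unbroken ce nBe.
  have be : prefix b e by apply: prefix_trans bp (prefix_parent e).
  have p1 : is_internal_tc t g (Lower e) by rewrite /= e0 ce.
  have p2 : is_internal_tc t g (Upper e) by rewrite /= ve ce.
  have h1 := hE (fun y => - gauge_param y b - dist (edge_length y) b (parent e))
    (exist (is_internal_tc t g) _ p1).
  have h2 := hE (fun y => gauge_param y b + dist (edge_length y) b e)
    (exist (is_internal_tc t g) _ p2).
  rewrite /iS /tc_lengths /= (negPf nBe) (root_ofE hb bp) (root_ofE hb be) in h1 h2.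
  apply: cvg_ext
    (cvgD (h1 erefl (fun _ _ => erefl)) (h2 erefl (fun _ _ => erefl))) _ _.
    by rewrite [dist _ b e]dist_parent //; ring.
  by apply: nearW => y; rewrite !fctE [dist _ b e]dist_parent //; ring.
have hd b v : b \in rs -> v \in vertices t -> prefix b v ->
    dist (edge_length y) b v @[y --> G] --> dist (edge_length y0) b v.
  move=> hb hv bv; rewrite /dist !big_nat.
  under eq_cvg do rewrite big_nat.
  apply: cvg_big => [|k kv]; first exact: add_continuous.
  by apply: hl; rewrite mem_obr (above_edge_unbroken hb hv bv kv).
apply: cvg_vec => //; first exact: uniq_broken_roots.
  by rewrite filter_uniq // uniq_omega.
move=> b hb; have := hb; rewrite mem_broken_roots => /and3P[Bb b0 vb].
have [cb|ncb] := boolP (crossed t g b).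
  have pb : is_internal_tc t g (Upper b) by rewrite /= vb cb.
  apply: (hE (fun y => gauge_param y b)
    (exist (is_internal_tc t g) _ pb)) => [|y _].
    by rewrite /iS /tc_lengths /= (root_ofE hb (prefix_refl b)) dist_refl addr0.
  by rewrite /iS /tc_lengths /= (root_ofE hb (prefix_refl b)) dist_refl addr0.
have gb : g b != Above.
  by have [_ _] := brB.1 _ Bb; rewrite (negPf ncb) orbF => /andP[].
have [[v [hv bv gv]]|[a [ca ba nBa]]] := gauge_above_root hb gb.
  have hS y : cellS y -> gauge_param y b = - dist (edge_length y) b v.
    by move=> [_ /(_ b v hb hv bv)]; rewrite gv => <-; rewrite opprK.
  apply: cvg_ext (cvgN (hd b v hb hv bv)) _ _; first by rewrite hS.
  by apply: filterS GS => y /hS ->.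
have pa : is_internal_tc t g (Lower a) by rewrite /= ca (crossed_nonroot ca).
have va := parent_vertex (crossed_edge ca) (crossed_nonroot ca).
have h1 := hE (fun y => - gauge_param y b - dist (edge_length y) b (parent a))
    (exist (is_internal_tc t g) _ pa).
rewrite /iS /tc_lengths /= (negPf nBa) (root_ofE hb ba) in h1.
apply: cvg_ext (cvgN (cvgD (h1 erefl (fun _ _ => erefl)) (hd b _ hb va ba))) _ _.
  by ring.
by apply: nearW => y; rewrite !fctE; ring.
Qed.

(** The finite lengths are functions of [to_broken x] alone, which therefore converges. A broken
    edge of length [s + f] then gives the parameter 1/s, also when that length tends to infinity. *)
Lemma retract_cvg (z : R * brokenT) (F : set_system gaugedT) : Filter F ->
  0 <= z.1 -> cellS z.2 -> F cellM ->
  (forall p, iM x p @[x --> F] --> collar_map iM iS collar_pt z p) ->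
  retract @ F --> z.
Proof.
move=> FF z0 Sz FM hF.
have hu : to_broken @ F --> z.2.
  apply: broken_tc_lengths_embedding => //.
    suff : F (to_broken @^-1` cellS) by [].
    by apply: filterS FM => x Mx; exact: to_broken_cell.
  move=> p; case: (tc_lengths_cases p) => [[f cf hf]|[f cf hf]]; last first.
    apply: cvg_ext (cvg_cst +oo%E) _ _; first by rewrite /iS (hf _).1.
    by apply: nearW => x /=; rewrite /iS (hf _).1.
  have : collar_map iM iS collar_pt z p = iS z.2 p.
    rewrite /collar_map; case: ifP => // _.
    by rewrite /iM /iS (hf _).1 /collar_pt (hf _).2.
  move/(cvg_ext (hF p)); apply; apply: nearW => x /=.
  by rewrite /iS (hf _).1 -[in LHS](unbreak_to_brokenK x) /iM (hf _).2.
have hs : (- gauge_param x [::])^-1 @[x --> F] --> z.1.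
  have [p [f cf hf]] := broken_tc_edge.
  have hfu : f (to_broken x) @[x --> F] --> f z.2.
    exact: (cvg_comp to_broken f hu (cf z.2)).
  have hp := hF p; rewrite /collar_map in hp.
  have sE x : iM x p = (- gauge_param x [::] + f (to_broken x))%:E.
    by rewrite -[in LHS](unbreak_to_brokenK x) /iM (hf _).2.
  move: hp; case: ifPn => [/eqP z10|z10].
    rewrite /iS (hf _).1 z10 => /cvgeyPge hp.
    apply/gtr0_cvgV0.
      by apply: filterS FM => x /cell_gauge_param_lt0; rewrite oppr_gt0.
    apply/cvgryPge => A.
    have h1 : \forall x \near F, f (to_broken x) < f z.2 + 1.
      by apply: (cvgr_lt _ hfu); rewrite ltrDl.
    apply: filterS2 h1 (hp (A + (f z.2 + 1))) => x /=.
    by rewrite sE lee_fin => h1 h2; lra.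
  rewrite /iM /collar_pt (hf _).2 => hp.
  have {}hp : - gauge_param x [::] + f (to_broken x) @[x --> F] --> z.1^-1 + f z.2.
    by apply: EFin_cvg; apply: cvg_ext hp _ _ => //; apply: nearW.
  have hl : - gauge_param x [::] @[x --> F] --> z.1^-1.
    apply: cvg_ext (cvgB hp hfu) _ _; first by rewrite addrK.
    by apply: nearW => x; rewrite !fctE; ring.
  by rewrite -[z.1]invrK; apply: cvgV hl; rewrite invr_eq0.
case: z {z0 Sz hF} hu hs => z1 z2 /= hu hs.
exact: cvg_pair hs hu.
Qed.

Lemma collar_map_continuous (V : set brokenT) (delta : R) :
  {within collar_dom cellS V delta,
    continuous (collar_map iM iS collar_pt)}.
Proof.
apply/subspace_continuousP => z hz; apply: ptws_cvg => p; rewrite /from_subspace.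
set D := collar_dom _ _ _ in hz *.
have toD (h : R * brokenT -> R) : {for z, continuous h} ->
    h z' @[z' --> within D (nbhs z)] --> h z.
  by move=> ch; apply: cvg_within_filter.
have toE (h : R * brokenT -> R) : {for z, continuous h} ->
    (h z')%:E @[z' --> within D (nbhs z)] --> (h z)%:E.
  by move=> /toD; exact: cvg_toEFin.
have c2 (f : brokenT -> R) : continuous f ->
    {for z, continuous (fun z' : R * brokenT => f z'.2)}.
  by move=> cf; apply: (cvg_comp snd f _ (cf z.2)); exact: cvg_snd.
case: (tc_lengths_cases p) => [[f cf hf]|[f cf hf]].
  have E z' : collar_map iM iS collar_pt z' p = (f z'.2)%:E.
    rewrite /collar_map; case: ifP => _; rewrite /iM /iS ?(hf _).1 //.
    by rewrite /collar_pt (hf _).2.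
  apply: cvg_ext (toE _ (c2 _ cf)) _ _; first by rewrite E.
  by apply: filterE => z'; rewrite E.
have E z' : collar_map iM iS collar_pt z' p =
    if z'.1 == 0 then +oo%E else (z'.1^-1 + f z'.2)%:E.
  rewrite /collar_map; case: ifP => _; rewrite /iM /iS ?(hf _).1 //.
  by rewrite /collar_pt (hf _).2.
have fst_cvg : {for z, continuous (fun z' : R * brokenT => z'.1)} by exact: cvg_fst.
have [/andP[z0 _] _] := hz.
have [z10|z10] := eqVneq z.1 0; last first.
  apply: cvg_ext (toE (fun z' => z'.1^-1 + f z'.2) _) _ _.
  - apply: continuousD; last exact: c2.
    exact: continuousV.
  - by rewrite E (negPf z10).
  - have nz : \forall z' \near within D (nbhs z), z'.1 != 0.
      by apply: (cvgr_neq0 _ (toD _ fst_cvg)).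
    by apply: filterS nz => z' z'0; rewrite E (negPf z'0).
rewrite E z10 eqxx; apply/cvgeyPge => A.
have h1 : \forall z' \near within D (nbhs z), f z.2 - 1 < f z'.2.
  by apply: (cvgr_gt _ (toD _ (c2 _ cf))); rewrite ltrBlDr ltrDl.
(* Since [f z'.2] exceeds [f z.2 - 1], an inverse parameter above [e] brings the sum above [A]; the
   added 1 keeps [e] positive. *)
pose e := `|A - f z.2 + 1| + 1.
have e0 : 0 < e by rewrite /e ltr_wpDl.
have h2 : \forall z' \near within D (nbhs z), z'.1 < e^-1.
  by apply: (cvgr_lt _ (toD _ fst_cvg)); rewrite z10 invr_gt0.
have h3 : within D (nbhs z) D by exact: withinT.
apply: filterS3 h1 h2 h3 => z' h1 h2 [/andP[z'0 _] _].
rewrite E; case: ifPn => [_|nz']; first by rewrite leey.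
rewrite lee_fin.
have : e < z'.1^-1 by rewrite -[e]invrK ltf_pV2 ?posrE ?invr_gt0 // lt0r nz'.
have := ler_norm (A - f z.2 + 1); rewrite /e; lra.
Qed.

Lemma collar_pt_is_diff (z : R * brokenT) : z.1 != 0 ->
  is_diff z collar_pt
    (fun h => (- z.1 ^- 2 * h.1) *: unbreak 1 0 + unbreak 0 h.2).
Proof.
move=> z0.
have -> : collar_pt = fun z => z.1^-1 *: unbreak 1 0 + unbreak 0 z.2.
  apply/funext => h; rewrite -unbreakP /collar_pt.
  by rewrite mulr1 addr0 scaler0 add0r.
apply: (is_diff_collar (unbreak 1 0) (L := unbreak 0)) => //.
  by move=> a u v; rewrite -unbreakP mulr0 addr0.
apply: (vec_continuous _ uniq_omega) => // [b|e he].
  rewrite inE => /eqP->.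
  have -> : (fun y => gauge_param (unbreak 0 y) [::]) = fun=> 0.
    by apply/funext => y; rewrite gauge_param_unbreak oppr0.
  by move=> y; exact: cst_continuous.
have -> : (fun y => edge_length (unbreak 0 y) e) = fun y => if B e then
    gauge_param y e - dist (edge_length y) [::] (parent e)
    else edge_length y e.
  by apply/funext => y; rewrite edge_length_mkvec // addr0.
case: (B e); last exact: edge_length_continuous.
by apply: continuous_subr;
        [exact: gauge_param_continuous | exact: dist_continuous].
Qed.

(** A closed linear subspace in which the broken cell is open; it cuts out the compact
    neighbourhoods used for the collar. *)
Definition gauge_equalities : set brokenT :=
  [set y | {in rs & vertices t, forall b v, prefix b v -> g v = On ->
     gauge_param y b + dist (edge_length y) b v = 0}].

Lemma cell_gauge_equalities : cellS `<=` gauge_equalities.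
Proof.
move=> y [_ hy] b v hb hv bv gv; have := hy b v hb hv bv.
by rewrite gv => <-; rewrite addrN.
Qed.

Lemma height_continuous b v :
  continuous (fun y : brokenT => gauge_param y b + dist (edge_length y) b v).
Proof.
by apply: continuous_addr;
      [exact: gauge_param_continuous | exact: dist_continuous].
Qed.

Lemma closed_gauge_equalities : closed gauge_equalities.
Proof.
move=> y hy b v hb hv bv gv.
have cl : closed ((fun y : brokenT =>
    gauge_param y b + dist (edge_length y) b v) @^-1` [set 0]).
  apply: closed_comp; last exact: closed_eq.
  by move=> x _; exact: height_continuous.
apply: cl; apply: closureS hy => x hx; exact: hx.
Qed.

(** Apart from the equalities, the cell is defined by finitely many strict inequalities between
    continuous functions. *)
Lemma cell_near (y0 : brokenT) : cellS y0 ->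
  \forall y \near y0, gauge_equalities y -> cellS y.
Proof.
move=> [hl hv].
have h1 : \forall y \near y0, {in obr, forall e, 0 < edge_length y e}.
  apply: filter_forall_in => e he.
  exact: (cvgr_gt _ (@edge_length_continuous R rs obr e y0) _ (hl e he)).
have h2 : \forall y \near y0, {in rs, forall b, {in vertices t, forall v,
    prefix b v -> g v != On ->
    position_ok (g v) (- gauge_param y b) (dist (edge_length y) b v)}}.
  apply: filter_forall_in => b hb; apply: filter_forall_in => v v_t.
  have [bv|nbv] := boolP (prefix b v); last exact: filterE.
  have hc := @height_continuous b v y0.
  have := hv b v hb v_t bv; case: (g v) => h; [|exact: filterE|].
    have : \forall y \near y0, gauge_param y b + dist (edge_length y) b v < 0.
      by apply: (cvgr_lt _ hc); lra.
    by apply: filterS => y hy _ _ /=; lra.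
  have : \forall y \near y0, 0 < gauge_param y b + dist (edge_length y) b v.
    by apply: (cvgr_gt _ hc); lra.
  by apply: filterS => y hy _ _ /=; lra.
apply: filterS2 h1 h2 => y h1 h2 heq; split=> // b v hb v_t bv.
have := h2 b hb v v_t bv; have := heq b v hb v_t bv.
case: (g v) => h h'; [exact: h'|have := h erefl; lra|exact: h'].
Qed.

Section CollarExists.
Variable y0 : brokenT.
Hypothesis Sy0 : cellS y0.

Let V : set brokenT := ball y0 1.
(** On [V] norms stay below [|y0| + 1], so 1/tau exceeds the bound of [unbreak_cell] when tau is
    below [delta]. *)
Let delta : R := (depth.+1%:R * (`|y0| + 1))^-1.

Lemma delta_gt0 : 0 < delta.
Proof. by rewrite invr_gt0 mulr_gt0 // ltr_wpDl. Qed.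

Lemma collar_pt_cell (z : R * brokenT) :
  collar_dom cellS V delta z -> 0 < z.1 -> cellM (collar_pt z).
Proof.
move=> [/andP[_ zd] [zV zS]] z0; apply: unbreak_cell => //.
have d0 := delta_gt0.
apply: (@lt_trans _ _ delta^-1); last by rewrite ltf_pV2.
rewrite /delta invrK ltr_pM2l //.
have : `|y0 - z.2| < 1 by move: zV; rewrite /V -ball_normE.
rewrite distrC => h.
have := ler_normD y0 (z.2 - y0); rewrite addrC subrK; lra.
Qed.

Lemma collar_exists : collar cellM iM cellS iS V delta collar_pt.
Proof.
apply: (@collar_of_retraction _ _ _ _ _ _ _ _ _ _ _ retract).
- by apply: ptws_hausdorff; exact: ereal_hausdorff.
- exact: delta_gt0.
- exact: collar_pt_cell.
- exact: collar_map_continuous.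
- exact: retractK.
- move=> z A [/andP[z0 _] [_ zS]] hA.
  (* The traces on the cell of the neighbourhoods of the collar point generate a filter along which
     [retract] has to converge. *)
  pose F := filter_from (nbhs (collar_map iM iS collar_pt z))
    (fun P => cellM `&` iM @^-1` P).
  have FF : Filter F.
    apply: filter_from_filter; first by exists setT; exact: filterT.
    move=> P Q hP hQ; exists (P `&` Q); first exact: filterI.
    by move=> x [Mx [Px Qx]].
  suff : retract @ F --> z.
    move=> /(_ A hA)[P hP PA]; exists P => // x Mx Px.
    by apply: PA.
  apply: retract_cvg => //.
    by exists setT; [exact: filterT | move=> x []].
  move=> p U hU; exists ((fun q : {ptws tc_edge t g -> \bar R} => q p) @^-1` U).
    exact: ptws_proj_cvg.
  by move=> x [].
- move=> z A [/andP[z0 zd] [zV zS]] hA.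
  have hz : \forall z' \near z, [/\ A z', z'.1 < delta, V z'.2 &
      gauge_equalities z'.2 -> cellS z'.2].
    have h1 : \forall z' \near z, z'.1 < delta.
      by apply: (cvgr_lt _ (@cvg_fst _ _ _ _ _)).
    have near2 (P : set brokenT) : nbhs z.2 P -> \forall z' \near z, P z'.2.
      move=> hP; exists (setT, P); first by split=> //; exact: filterT.
      by move=> x [].
    have h2 : \forall z' \near z, V z'.2.
      by apply: near2; apply: open_nbhs_nbhs; split=> //; exact: ball_open.
    have h3 := near2 _ (cell_near zS).
    apply: filterS3 (filterI hA h1) h2 h3 => z' [? ?] ? ?; split => //.
  have /nbhs_ballP[e /= e0 he] := hz.
  (* A closed box inside the ball of radius [e]. Intersecting it with [C] restores the two closed
     conditions of the collar domain, and the ball gives the open ones. *)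
  pose box := `[z.1 - e / 2, z.1 + e / 2]%classic `*`
    [set y | `|z.2 - y| <= e / 2].
  pose C := [set z' : R * brokenT | 0 <= z'.1] `&`
    [set z' | gauge_equalities z'.2].
  exists (box `&` C), (ball z (e / 2)); split.
  + apply: compact_closedI.
      apply: compact_setX; first exact: segment_compact.
      apply: bounded_closed_compact.
        exists (`|z.2| + e / 2); split=> [|M hM y /= hy]; first exact: num_real.
        have := ler_normB z.2 (z.2 - y); rewrite subKr => h; lra.
      apply: (closed_comp _ (@closed_le _ (e / 2))) => y _.
      apply: continuous_comp; last exact: norm_continuous.
      by apply: continuousB; [exact: cst_continuous | exact: id].
    apply: closedI; last first.
      by apply: (closed_comp _ closed_gauge_equalities) => x _; exact: cvg_snd.
    by apply: (closed_comp _ (@closed_ge _ 0)) => x _; exact: cvg_fst.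
  + move=> z' [[]]; rewrite /= in_itv /= => /andP[h1 h2] h3 [h4 h5].
    have [] := he z'.
      split; rewrite -ball_normE /= ?ltr_norml; last lra.
      by apply/andP; split; lra.
    by move=> Az' hd hV /(_ h5) hS; split=> //; split=> //; rewrite h4.
  + by apply: nbhsx_ballx; rewrite divr_gt0.
  + move=> x Mx []; rewrite -!ball_normE /= ltr_norml => /andP[h1 h2] h3.
    have [r0 _] := retractK Mx; split; split=> /=; rewrite ?ltW //.
      by rewrite in_itv /=; apply/andP; split; rewrite /= in h1 h2; lra.
    by apply: cell_gauge_equalities; exact: to_broken_cell.
- move=> z hz z0; have := collar_pt_is_diff (lt0r_neq0 z0).
  by case.
Qed.

End CollarExists.

(** * The chart, its determinant and the boundary sign *)

Definition chart (x : gaugedT) : 'rV[R]_(1 + (size rs + size obr)) :=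
  row_mx (gauge_param x [::])%:M (to_broken x).

Lemma chart_linear : linear chart.
Proof.
move=> a u v; rewrite /chart gauge_paramP to_brokenP raddfD /=.
by rewrite scale_row_mx add_row_mx scale_scalar_mx.
Qed.

Lemma chart_unbreak s y : chart (unbreak s y) = row_mx (- s)%:M y.
Proof. by rewrite /chart gauge_param_unbreak to_broken_unbreakK. Qed.

Let Q : 'M[R]_(size [:: [::] : address] + size omega, 1 + (size rs + size obr)) :=
  \matrix_i chart (delta_mx ord0 i).

(** Heights are the same functions before and after breaking, so their gradients are pulled back by
    the chart and have no component along lambda. *)
Lemma coorientation_chart :
  coorientation t g [:: [::]] omega =
  [seq row_mx (0 : 'rV_1) v *m Q^T | v <- coorientation t g rs obr].
Proof.
rewrite /coorientation [LHS]/= cats0.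
rewrite (eq_filter (a2 := predT)) => [|v]; last by rewrite /= prefix0s.
rewrite filter_predT -{1}gauge_vertices_broken -/rs !map_flatten -!map_comp.
congr flatten; apply/eq_in_map => b hb; rewrite /= -map_comp.
apply/eq_in_map => v; rewrite !mem_filter => /and3P[bv _ hv] /=.
apply: trmx_inj; rewrite trmx_mul trmxK.
have lS a (x y : brokenT) :
    gauge_param (a *: x + y) b + dist (edge_length (a *: x + y)) b v =
    a * (gauge_param x b + dist (edge_length x) b v) +
    (gauge_param y b + dist (edge_length y) b v).
  by rewrite gauge_paramP distP; ring.
apply/row_matrixP => i; rewrite row_mul rowK.
rewrite /chart tr_row_mx mul_row_col trmx0 mulmx0 add0r.
rewrite (gradient_mul (f := fun x : brokenT =>
    gauge_param x b + dist (edge_length x) b v)) // height_to_broken //.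
by apply/rowP => k; rewrite (ord1 k) !mxE eqxx mulr1n.
Qed.

Lemma edge_length_delta i e : e \in omega ->
  edge_length (delta_mx ord0 (rshift 1 i) : gaugedT) e =
  (e == nth [::] omega i)%:R.
Proof.
move=> he; have hi : (index e omega < size omega)%N by rewrite index_mem.
rewrite /edge_length (coordE _ (rshift 1 (Ordinal hi))) mxE eqxx /=.
congr (_%:R); rewrite eq_rshift -val_eqE /=; congr (nat_of_bool _).
apply/eqP/eqP => [<-|->]; first by rewrite nth_index.
by rewrite index_uniq // uniq_omega.
Qed.

Lemma uniq_broken_edges : uniq (rs ++ obr).
Proof.
rewrite cat_uniq uniq_broken_roots // filter_uniq ?uniq_omega // andbT.
apply/hasPn => e; rewrite mem_filter => /andP[nBe _].
by apply/negP; rewrite /= mem_broken_roots (negPf nBe).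
Qed.

Lemma chart_dim : (size [:: [::] : address] + size omega =
  1 + (size rs + size obr))%N.
Proof. by rewrite size_broken. Qed.

(* Up to the permutation [eps], the chart is unitriangular: the expression
   [lambda + d(r, b)] only involves one breaking edge, namely [b]. *)
Lemma det_chart (eps : 'S_(size omega)) :
  (forall i : 'I_(size omega),
     nth [::] omega i = nth [::] (rs ++ obr) (eps i)) ->
  \det (castmx (chart_dim, erefl) Q) = (-1) ^+ eps.
Proof.
move=> heps; rewrite det_castmx.
set X := castmx _ _.
have XE i k : X i k = chart (delta_mx ord0 i) ord0 (cast_ord chart_dim k).
  by rewrite castmxE esymK cast_ord_id mxE.
rewrite -[X](@submxK _ 1 _ 1).
have c0 : cast_ord chart_dim (lshift _ (0 : 'I_1)) = lshift _ 0 by apply: val_inj.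
have gd i : gauge_param (delta_mx ord0 i : gaugedT) [::] = (lshift _ ord0 == i)%:R.
  rewrite /gauge_param (coordE _ (lshift (size omega) (ord0 : 'I_1))) mxE eqxx.
  by rewrite eq_sym.
rewrite (_ : dlsubmx _ = 0); last first.
  apply/matrixP => i k; rewrite (ord1 k) !mxE XE c0 row_mxEl mxE eqxx gd.
  by rewrite eq_lrshift.
rewrite det_ublock det_mx11 !mxE XE c0 row_mxEl mxE eqxx gd eqxx mul1r.
(* Rows are reordered as [rs ++ obr]. Among broken roots a prefix is an equality, and the unbroken
   edges come later, so [U] is lower unitriangular. *)
pose U : 'M[R]_(size omega) := \matrix_(i, k)
  if (k < size rs)%N then
    (prefix (nth [::] (rs ++ obr) i) (nth [::] (rs ++ obr) k))%:R
  else (i == k)%:R.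
have sZ : size (rs ++ obr) = size omega by rewrite size_cat size_broken.
have -> : drsubmx (X : 'M[R]_(1 + size omega)) = perm_mx eps *m U.
  rewrite -row_permE; apply/matrixP => i k; rewrite !mxE XE.
  have kN' : (k < size rs + size obr)%N by rewrite size_broken.
  have -> : cast_ord chart_dim (rshift 1 k) = rshift 1 (Ordinal kN').
    exact: val_inj.
  rewrite row_mxEr mxE /= -heps gd eq_lrshift add0r nth_cat.
  have oi : nth [::] omega i \in omega by rewrite mem_nth.
  case: ifPn => kr.
    have hb : nth [::] rs k \in rs by rewrite mem_nth.
    rewrite -dist_indicator; last by move: oi; rewrite mem_omega => /andP[].
    apply: eq_dist => l /andP[_ lb]; apply: edge_length_delta.
    have := rs_omega hb; rewrite !mem_omega => /andP[_ vb].
    rewrite vertices_take // andbT -size_eq0 size_takel //.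
  rewrite edge_length_delta; last first.
    have : nth [::] obr (k - size rs) \in obr.
      by rewrite mem_nth // ltn_subLR // leqNgt.
    by rewrite mem_filter => /andP[].
  have := nth_uniq [::] _ _ uniq_broken_edges; move/(_ (eps i) k).
  rewrite sZ !ltn_ord => /(_ isT isT).
  by rewrite -heps nth_cat (negPf kr) eq_sym => ->.
rewrite det_mulmx det_perm det_trig; last first.
  apply/is_trig_mxP => i k ik; rewrite mxE.
  case: ifPn => kr; last by rewrite -val_eqE /= ltn_eqF.
  have ir : (i < size rs)%N by exact: ltn_trans kr.
  rewrite !nth_cat kr ir; case: (boolP (prefix _ _)) => // pik.
  have hi := mem_nth [::] ir; have hk := mem_nth [::] kr.
  have /eqP := broken_root_uniq hi hk pik (prefix_refl _).
  by rewrite nth_uniq ?uniq_broken_roots // ltn_eqF.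
rewrite big1 ?mulr1 // => i _; rewrite mxE prefix_refl eqxx.
by case: ifP.
Qed.

Lemma below_break_bears_sign (eps : 'S_(size omega)) :
  (forall i : 'I_(size omega),
     nth [::] omega i = nth [::] (rs ++ obr) (eps i)) ->
  bears_sign cellM (coorientation t g [:: [::]] omega) iM
    cellS (coorientation t g rs obr) iS
    (odd_perm eps + 1 + size (gauge_vertices t g)).
Proof.
move=> heps.
have snu : size (coorientation (R := R) t g rs obr) = size (gauge_vertices t g).
  rewrite -gauge_vertices_broken /coorientation !size_flatten /shape -!map_comp.
  by congr sumn; apply: eq_map => b /=; rewrite size_map.
split; first by rewrite coorientation_chart size_map chart_dim.
move=> y0 Sy0.
exists (ball y0 1), (depth.+1%:R * (`|y0| + 1))^-1, collar_pt; split.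
- exact: ball_open.
- exact: ballxx.
- exact: delta_gt0.
- exact: collar_exists.
move=> y tau us _ _ /andP[tau0 _] sus tan.
have tau_neq0 : (tau, y).1 != 0 by rewrite gt_eqF.
have [_ dE] := collar_pt_is_diff tau_neq0.
(* Along -d/dtau, 1/tau grows at rate [tau ^- 2]; as lambda = -1/tau, the chart coordinate is
   [- tau ^- 2]. *)
have -> : 'd collar_pt (tau, y) (-1, 0) = unbreak (tau ^- 2) 0.
  rewrite dE /= -unbreakP; congr unbreak; first by ring.
  by rewrite scaler0 addr0.
have -> : [seq 'd collar_pt (tau, y) (0, u) | u <- us] =
    [seq unbreak 0 u | u <- us].
  by apply: eq_map => u; rewrite dE /= mulr0 scale0r add0r.
have detQ := det_chart heps.
rewrite coorientation_chart.
rewrite (sgr_frame_det (e := chart_dim) (Q := Q) (a := - tau ^- 2)) //.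
- rewrite detQ sgrX sgrN sgr1 snu mulrA -exprD addn1 addSn addnS.
  by [].
- by rewrite detQ signr_eq0.
- by rewrite oppr_lt0 invr_gt0 exprn_gt0.
- by rewrite mulmx_delta_rows ?chart_unbreak //; exact: chart_linear.
- move=> u; rewrite mulmx_delta_rows; last exact: chart_linear.
  by rewrite chart_unbreak oppr0 raddf0.
Qed.

End Break.

Theorem proposition12 (R : realType) (n j : nat) (t : ribbon_tree)
    (g : address -> position) (omega : seq address) (B : pred address)
    (eps : 'S_(size omega)) :
  (2 <= n)%N -> arity t = n -> stable t -> is_gauge t g ->
  size (gauge_vertices t g) = j ->
  perm_eq omega (internal_edges t) ->
  below_break t g B ->
  let rs := broken_roots t B in
  let omega_br := [seq e <- omega | ~~ B e] in
  (forall i : 'I_(size omega),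
     nth [::] omega i = nth [::] (rs ++ omega_br) (eps i)) ->
  bears_sign
    (@cell R t g [:: [::]] omega) (coorientation t g [:: [::]] omega)
    (@tc_lengths R t g pred0 [:: [::]] omega)
    (@cell R t g rs omega_br) (coorientation t g rs omega_br)
    (@tc_lengths R t g B rs omega_br)
    (odd_perm eps + 1 + j).
Proof.
move=> n2 nE st gauge_g <- om_t brB rs omega_br heps.
(* Arity at least 2 excludes the tree reduced to one edge. *)
have t_root : [::] \in vertices t by case: (t) nE n2 => // <-.
exact: below_break_bears_sign.
Qed.
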